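(* Let $f(z)=z+a_2z^2+a_3z^3+\cdots$ belong to the class $\mathcal{U}$. Then $$|a_2a_4-a_3^2|\le 1\quad\text{and}\quad \left|a_3(a_2a_4-a_3^2)-a_4(a_4-a_2a_3)+a_5(a_3-a_2^2)\right|\le \frac14,$$ and both estimates are sharp.
   Context: Let $\mathbb{D}=\{z\in\mathbb{C}:|z|<1\}$ and let $\mathcal{A}$ be the family of functions $f$ analytic in $\mathbb{D}$ with $f(0)=0$, $f'(0)=1$. The class $\mathcal{U}$ consists of all $f\in\mathcal{A}$ such that $\left|\left[\frac{z}{f(z)}\right]^2 f'(z)-1\right|<1$ for all $z\in\mathbb{D}$. The quantities $a_2a_4-a_3^2$ and $a_3(a_2a_4-a_3^2)-a_4(a_4-a_2a_3)+a_5(a_3-a_2^2)$ are the second Hankel determinant $H_2(2)$ and the third Hankel determinant $H_3(1)$ of $f$, respectively. *)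

(* Defs.v *)
From Stdlib Require Import Reals.
From Coquelicot Require Import Coquelicot.

Open Scope C_scope.

Definition in_disc (z : C) : Prop := (Cmod z < 1)%R.

Definition in_class_A (f : C -> C) (a : nat -> C) : Prop :=
  a 0%nat = 0 /\ a 1%nat = 1 /\
  (forall z : C, in_disc z -> is_pseries a z (f z)).

(* The class U: |(z/f(z))^2 f'(z) - 1| < 1 on D.  For z = 0 the quantity
   is 0 by analytic continuation (z/f(z) -> 1), so only z <> 0 is imposed;
   there z/f(z) must be defined, i.e. f(z) <> 0.  f'(z) is the complex
   derivative (Coquelicot's is_derive over C). *)
Definition in_class_U (f : C -> C) (a : nat -> C) : Prop :=
  in_class_A f a /\
  forall z : C, in_disc z -> z <> 0 ->
    f z <> 0 /\
    exists d : C, is_derive f z d /\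
      (Cmod ((z / f z) ^ 2 * d - 1) < 1)%R.

Definition H22 (a : nat -> C) : C :=
  a 2%nat * a 4%nat - a 3%nat ^ 2.

Definition H31 (a : nat -> C) : C :=
  a 3%nat * (a 2%nat * a 4%nat - a 3%nat ^ 2)
  - a 4%nat * (a 4%nat - a 2%nat * a 3%nat)
  + a 5%nat * (a 3%nat - a 2%nat ^ 2).

(* Main.v *)
(** With [g = z / f = 1 - a_2 z + z^2 k], the defining expression of U is
    [- z^2 H] where [H = k + z k'] is holomorphic, and the maximum principle
    gives [|H| <= 1].  If [H = d_0 + d_1 z + d_2 z^2 + ...], then
    [H_2(2) = - a_2 d_1 / 2 - d_0^2] and [H_3(1) = d_0 d_2 / 3 - d_1^2 / 4].
    [H_3(1)] is bounded through Bessel's inequality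
    [|d_0|^2 + |d_1|^2 + |d_2|^2 <= 1], and [H_2(2)] through
    [|d_1| <= 1 - |d_0|^2] and [|a_2| <= 2].  For the latter, [|k| <= 1];
    if [|a_2| > 2], then on a suitable circle [- a_2 z] dominates
    [1 + z^2 k], so [Re (- a_2 f) >= 1/2] there, although [f 0 = 0].
    The only analytic input is that [Re F] at the centre is at most its
    maximum on a circle.  Extremal functions: [z / (1 - z^2)] and
    [z / (1 - z^3 / 2)]. *)

Require Import Defs.
From Stdlib Require Import Reals Lra Lia.
From Coquelicot Require Import Coquelicot.

Local Open Scope C_scope.

(** * Complex differentiability *)

(** Write [g = 1 + b_1 z + b_2 z^2 + ...]. Both determinants become 2 by 2 in the coefficients of
    [g]: [H_2(2) = b_1 b_3 - b_2^2] and [H_3(1) = b_2 b_4 - b_3^2]. Since [(z / f)^2 f' = g - z g'],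
    the defining condition is linear in [g], and [d_n = (n + 1) b_{n+2}]; the weights 1/2, 1/3 and
    1/4 come from there. The coefficient [b_1 = - a_2] cancels in [g - z g'], so [|a_2| <= 2] cannot
    be read off from [H] alone: it also uses that [g] has no zero in the disc. Each inequality for
    [H] results from a well-chosen holomorphic test function, whose real part is estimated on the
    circles [|z| = r] before [r] tends to 1. The mean value property behind this asks for a
    continuous complex derivative. Remainders of Taylor expansions therefore have to be visibly
    smooth: they are built by peeling coefficients off power series and by an exact polynomial
    identity for the reciprocal. *)

(** The two structures on the target give the same little-o statement. Passing between them gives
    access to the product and chain rules, which are stated for a ring acting on itself. *)
Lemma is_derive_C_AbsRing (f : C -> C) (z d : C) :
  is_derive f z d <-> @is_derive C_AbsRing (AbsRing_NormedModule C_AbsRing) f z d.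
Proof.
split; intros [[H1 H2 H3] H4]; (split; [now constructor | exact H4]).
Qed.

Lemma C_is_derive_id (z : C) : is_derive (fun w : C => w) z (RtoC 1).
Proof. apply is_derive_C_AbsRing. exact (is_derive_id (K := C_AbsRing) z). Qed.

Lemma C_is_derive_mult (f g : C -> C) (z df dg : C) :
  is_derive f z df -> is_derive g z dg ->
  is_derive (fun w => f w * g w) z (df * g z + f z * dg).
Proof.
intros Hf Hg.
apply is_derive_C_AbsRing in Hf, Hg. apply is_derive_C_AbsRing.
exact (is_derive_mult f g z df dg Hf Hg Cmult_comm).
Qed.

Lemma C_is_derive_plus (f g : C -> C) (z df dg : C) :
  is_derive f z df -> is_derive g z dg ->
  is_derive (fun w => f w + g w) z (df + dg).
Proof.
intros Hf Hg. exact (is_derive_plus f g z df dg Hf Hg).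
Qed.

Lemma C_is_derive_eps (f : C -> C) (z d : C) :
  is_derive f z d <->
  forall eps : R, (0 < eps)%R -> exists delta : R, (0 < delta)%R /\
    forall w, (Cmod (w - z) < delta)%R ->
      (Cmod (f w - f z - (w - z) * d) <= eps * Cmod (w - z))%R.
Proof.
split.
- intros [_ H] eps He.
  destruct (H z (fun P HP => HP) (mkposreal eps He)) as [delta Hd].
  exists delta; split; [apply cond_pos|].
  intros w Hw. exact (Hd w Hw).
- intros H; split.
  + apply is_linear_scal_l.
  + intros x Hx.
    assert (E : z = x) by exact (is_filter_lim_locally_unique (V := AbsRing_NormedModule C_AbsRing) z x Hx). subst x.
    intros eps. destruct (H eps (cond_pos eps)) as (delta & Hp & Hd).
    exists (mkposreal delta Hp). intros w Hw. exact (Hd w Hw).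
Qed.

Lemma C_is_derive_inv (z : C) : z <> 0 -> is_derive Cinv z (- / (z * z)).
Proof.
intros Hz.
apply C_is_derive_eps. intros eps He.
assert (P : (0 < Cmod z)%R) by now apply Cmod_gt_0.
assert (Q : (0 < Cmod z ^ 3 * eps / 2)%R).
{ apply Rmult_lt_0_compat; [|lra]. apply Rmult_lt_0_compat; [|lra]. now apply pow_lt. }
(* The first bound gives [|w| > |z| / 2], so the remainder [(w - z)^2 / (w z^2)] is at most
   [2 |w - z|^2 / |z|^3]; the second bound makes this at most [eps |w - z|]. *)
exists (Rmin (Cmod z / 2) (Cmod z ^ 3 * eps / 2))%R. split; [apply Rmin_pos; lra|].
intros w Hw.
assert (H1 : (Cmod (w - z) < Cmod z / 2)%R) by (eapply Rlt_le_trans; [exact Hw|apply Rmin_l]).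
assert (H2 : (Cmod (w - z) < Cmod z ^ 3 * eps / 2)%R) by (eapply Rlt_le_trans; [exact Hw|apply Rmin_r]).
assert (H3 : (Cmod z / 2 < Cmod w)%R).
{ pose proof (Cmod_triangle w (- (w - z))) as T.
  replace (w + - (w - z)) with z in T by ring. rewrite Cmod_opp in T. lra. }
assert (Hw0 : w <> 0) by (apply Cmod_gt_0; lra).
replace (/ w - / z - (w - z) * - / (z * z)) with ((w - z) * (w - z) / (w * (z * z))) by (field; auto).
rewrite Cmod_div, !Cmod_mult by (repeat apply Cmult_neq_0; auto).
set (D := Cmod (w - z)) in *. assert (HD : (0 <= D)%R) by apply Cmod_ge_0.
set (W := Cmod w) in *. set (Z := Cmod z) in *.
assert (HW : (0 < W * (Z * Z))%R) by (repeat apply Rmult_lt_0_compat; lra).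
assert (H4 : (D / (W * (Z * Z)) <= eps)%R).
{ apply Rmult_le_reg_r with (W * (Z * Z))%R; [exact HW|].
  unfold Rdiv. rewrite Rmult_assoc, Rinv_l by lra.
  apply Rle_trans with (Z ^ 3 * eps / 2)%R; [lra|].
  assert (0 < eps * (Z * Z))%R by nra. nra. }
replace (D * D / (W * (Z * Z)))%R with (D / (W * (Z * Z)) * D)%R by (unfold Rdiv; ring).
now apply Rmult_le_compat_r.
Qed.

Lemma C_is_derive_comp (f g : C -> C) (z df dg : C) :
  is_derive f (g z) df -> is_derive g z dg ->
  is_derive (fun w => f (g w)) z (dg * df).
Proof.
intros Hf Hg.
apply is_derive_C_AbsRing in Hg.
exact (is_derive_comp f g z df dg Hf Hg).
Qed.

Lemma C_is_derive_continuous (f : C -> C) (z d : C) :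
  is_derive f z d -> continuous f z.
Proof.
intros H. assert (K := ex_derive_continuous f z (ex_intro _ d H)).
intros P HP. apply locally_C. exact (K P HP).
Qed.

Lemma C_is_derive_uniq (f : C -> C) (z d1 d2 : C) :
  is_derive f z d1 -> is_derive f z d2 -> d1 = d2.
Proof.
intros H1 H2. rewrite C_is_derive_eps in H1, H2.
destruct (Ceq_dec d1 d2) as [E|E]; [exact E|exfalso].
assert (P : (0 < Cmod (d1 - d2))%R).
{ apply Cmod_gt_0. intros H. apply E. replace d1 with (d1 - d2 + d2) by ring. rewrite H. ring. }
destruct (H1 (Cmod (d1 - d2) / 4)%R ltac:(lra)) as (u & Hu & K1).
destruct (H2 (Cmod (d1 - d2) / 4)%R ltac:(lra)) as (v & Hv & K2).
set (t := (Rmin u v / 2)%R).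
assert (Ht : (0 < t)%R) by (unfold t; assert (0 < Rmin u v)%R by (apply Rmin_pos; lra); lra).
assert (Hm : Cmod (z + t - z) = t) by (replace (z + t - z) with (RtoC t) by ring; rewrite Cmod_R; apply Rabs_pos_eq; lra).
specialize (K1 (z + t)). specialize (K2 (z + t)). rewrite Hm in K1, K2.
assert (t < u)%R by (unfold t; pose proof (Rmin_l u v); unfold t in Ht; lra).
assert (t < v)%R by (unfold t; pose proof (Rmin_r u v); unfold t in Ht; lra).
specialize (K1 H). specialize (K2 H0).
set (A := f (z + t) - f z - (z + t - z) * d1) in *.
set (B := f (z + t) - f z - (z + t - z) * d2) in *.
pose proof (Cmod_triangle B (- A)) as T. rewrite Cmod_opp in T.
replace (B + - A) with (RtoC t * (d1 - d2)) in T by (unfold A, B; ring).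
rewrite Cmod_mult, Cmod_R, (Rabs_pos_eq t) in T by lra.
nra.
Qed.

(** * Holomorphic functions on the unit disc *)

Lemma continuous_Cmult {U : UniformSpace} (f g : U -> C) (x : U) :
  continuous f x -> continuous g x -> continuous (fun u => f u * g u) x.
Proof.
intros Hf Hg.
assert (K : @continuous U (AbsRing_UniformSpace C_AbsRing) (fun u => f u * g u) x).
{ apply (continuous_mult (K := C_AbsRing) f g).
  - intros P HP. apply Hf. now apply locally_C.
  - intros P HP. apply Hg. now apply locally_C. }
intros P HP. apply K. now apply (locally_C (f x * g x) P).
Qed.

Lemma continuous_Cplus {U : UniformSpace} (f g : U -> C) (x : U) :
  continuous f x -> continuous g x -> continuous (fun u => f u + g u) x.
Proof.
intros Hf Hg.
assert (K : @continuous U (AbsRing_UniformSpace C_AbsRing) (fun u => f u + g u) x).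
{ apply (continuous_plus (V := AbsRing_NormedModule C_AbsRing) f g).
  - intros P HP. apply Hf. now apply locally_C.
  - intros P HP. apply Hg. now apply locally_C. }
intros P HP. apply K. now apply (locally_C (f x + g x) P).
Qed.

Lemma locally_disc (z : C) : in_disc z ->
  @locally (AbsRing_UniformSpace C_AbsRing) z in_disc.
Proof.
intros Hz. assert (P : (0 < 1 - Cmod z)%R) by (unfold in_disc in Hz; lra).
assert (K : forall w, (Cmod (w - z) < 1 - Cmod z)%R -> in_disc w).
{ intros w H. unfold in_disc. pose proof (Cmod_triangle (w - z) z) as T.
  replace (w - z + z) with w in T by ring. lra. }
exists (mkposreal _ P). intros w Hw. exact (K w Hw).
Qed.

(** The class of [n] times continuously complex differentiable functions on the disc. Counting the
    order avoids any appeal to the infinite differentiability of holomorphic functions: each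
    derivative taken costs one order, and order 1 suffices for the mean value property. *)
Fixpoint hol (n : nat) (F : C -> C) : Prop :=
  match n with
  | O => forall z, in_disc z -> continuous F z
  | S m => exists F' : C -> C,
      (forall z, in_disc z -> is_derive F z (F' z)) /\ hol m F'
  end.

Lemma hol_continuous (n : nat) (F : C -> C) (z : C) :
  hol n F -> in_disc z -> continuous F z.
Proof.
destruct n as [|n]; simpl.
- auto.
- intros (F' & H & _) Hz. exact (C_is_derive_continuous _ _ _ (H z Hz)).
Qed.

Lemma hol_pred (n : nat) (F : C -> C) : hol (S n) F -> hol n F.
Proof.
revert F. induction n as [|n IH]; intros F H.
- intros z. exact (hol_continuous 1 F z H).
- destruct H as (F' & H & H'). exists F'. split; [exact H|]. now apply IH.
Qed.

Lemma hol_ext (n : nat) (F G : C -> C) :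
  (forall z, in_disc z -> F z = G z) -> hol n F -> hol n G.
Proof.
destruct n as [|n]; simpl; intros E H.
- intros z Hz. 
  apply (continuous_ext_loc G F); [|now apply H].
  apply locally_C.
  apply (filter_imp in_disc); [exact E | now apply locally_disc].
- destruct H as (F' & H & H'). exists F'. split; [|exact H'].
  intros z Hz. apply (is_derive_ext_loc F); [|now apply H].
  apply (filter_imp in_disc); [exact E | now apply locally_disc].
Qed.

Lemma hol_const (n : nat) (c : C) : hol n (fun _ => c).
Proof.
revert c. induction n as [|n IH]; intros c.
- intros z _. apply continuous_const.
- exists (fun _ => 0). split; [|apply IH].
  intros z _. exact (is_derive_const c z).
Qed.

Lemma hol_id (n : nat) : hol n (fun z => z).
Proof.
destruct n as [|n].
- intros z _. apply continuous_id.
- exists (fun _ => 1). split; [|apply hol_const].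
  intros z _. apply C_is_derive_id.
Qed.

Lemma hol_plus (n : nat) (F G : C -> C) :
  hol n F -> hol n G -> hol n (fun z => F z + G z).
Proof.
revert F G. induction n as [|n IH]; intros F G HF HG.
- intros z Hz. apply continuous_Cplus; [now apply HF | now apply HG].
- destruct HF as (F' & HF & HF'), HG as (G' & HG & HG').
  exists (fun z => F' z + G' z). split; [|now apply IH].
  intros z Hz. apply C_is_derive_plus; auto.
Qed.

Lemma hol_mult (n : nat) (F G : C -> C) :
  hol n F -> hol n G -> hol n (fun z => F z * G z).
Proof.
revert F G. induction n as [|n IH]; intros F G HF HG.
- intros z Hz. apply continuous_Cmult; [now apply HF | now apply HG].
- pose proof (hol_pred _ _ HF) as KF. pose proof (hol_pred _ _ HG) as KG.
  destruct HF as (F' & HF & HF'), HG as (G' & HG & HG').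
  exists (fun z => F' z * G z + F z * G' z). split; [|now apply hol_plus; apply IH].
  intros z Hz. apply C_is_derive_mult; auto.
Qed.

Lemma hol_opp (n : nat) (F : C -> C) : hol n F -> hol n (fun z => - F z).
Proof.
intros H. apply (hol_ext n (fun z => - (1) * F z)); [intros; ring|].
apply hol_mult; [apply hol_const | exact H].
Qed.

Lemma hol_minus (n : nat) (F G : C -> C) :
  hol n F -> hol n G -> hol n (fun z => F z - G z).
Proof. intros HF HG. apply hol_plus; [exact HF | now apply hol_opp]. Qed.

Lemma hol_comp (n : nat) (F G : C -> C) :
  (forall z, in_disc z -> in_disc (G z)) ->
  hol n F -> hol n G -> hol n (fun z => F (G z)).
Proof.
intros HD. revert F. induction n as [|n IH]; intros F HF HG.
- intros z Hz. apply (continuous_comp G F); [now apply HG | apply HF; auto].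
- pose proof (hol_pred _ _ HG) as KG.
  destruct HF as (F' & HF & HF'), HG as (G' & HG & HG').
  exists (fun z => G' z * F' (G z)). split; [|apply hol_mult; auto].
  intros z Hz. apply C_is_derive_comp; auto.
Qed.

Lemma hol_inv (n : nat) (F : C -> C) :
  (forall z, in_disc z -> F z <> 0) ->
  hol n F -> hol n (fun z => / F z).
Proof.
intros HD. revert F HD. induction n as [|n IH]; intros F HD HF.
- intros z Hz. apply (continuous_comp F Cinv); [now apply HF|].
  exact (C_is_derive_continuous _ _ _ (C_is_derive_inv _ (HD z Hz))).
- pose proof (hol_pred _ _ HF) as KF.
  destruct HF as (F' & HF & HF').
  exists (fun z => F' z * - (/ F z * / F z)). split.
  + intros z Hz.
    replace (/ F z * / F z) with (/ (F z * F z)) by (field; auto).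
    apply (C_is_derive_comp Cinv F); [apply C_is_derive_inv|]; auto.
  + apply hol_mult; [exact HF'|]. apply hol_opp. apply hol_mult; now apply IH.
Qed.

Lemma hol_pow (n m : nat) (F : C -> C) : hol n F -> hol n (fun z => F z ^ m).
Proof.
intros H. induction m as [|m IH]; [exact (hol_const n 1)|].
exact (hol_mult n F (fun z => F z ^ m) H IH).
Qed.

Ltac hol_auto :=
  lazymatch goal with
  | |- hol ?n (fun _ => ?c) => exact (hol_const n c)
  | |- hol ?n (fun z => z) => exact (hol_id n)
  | |- hol ?n (fun z => @?F z + @?G z) => apply (hol_plus n F G); hol_auto
  | |- hol ?n (fun z => @?F z - @?G z) => apply (hol_minus n F G); hol_auto
  | |- hol ?n (fun z => - @?F z) => apply (hol_opp n F); hol_auto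
  | |- hol ?n (fun z => @?F z * @?G z) => apply (hol_mult n F G); hol_auto
  | |- hol ?n (fun z => @?F z ^ ?m) => apply (hol_pow n m F); hol_auto
  | |- hol ?n (fun z => ?F z) => change (hol n F); try assumption
  | _ => idtac
  end.

(** * The mean value property *)

Lemma is_derive_pair (f g : R -> R) (t a b : R) :
  is_derive f t a -> is_derive g t b ->
  is_derive (fun u => (f u, g u)) t (a, b).
Proof.
intros Hf Hg.
assert (K := filterdiff_comp'_2 f g (fun x y => (x, y) : C_R_NormedModule) t _ _
  (fun x y => (x, y)) Hf Hg).
apply (filterdiff_ext_lin _ (fun y : R => (scal y a, scal y b) : C_R_NormedModule));
  [|reflexivity].
apply K.
apply (filterdiff_ext (fun p : R * R => p)); [now intros []|].
apply (filterdiff_ext_lin _ (fun p => p)); [apply filterdiff_id | now intros []].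
Qed.

Lemma continuous_pair {U : UniformSpace} (f g : U -> R) (x : U) :
  continuous f x -> continuous g x -> continuous (fun u => (f u, g u) : C) x.
Proof.
intros Hf Hg.
apply (continuous_comp_2 f g (fun a b => (a, b) : R * R) x Hf Hg).
apply (continuous_ext (fun p : R * R => p)); [now intros []|].
apply continuous_id.
Qed.

(** The real differential of a complex differentiable map is multiplication by its derivative; this
    lets real calculus act along paths in the disc. *)
Lemma filterdiff_C_R (F : C -> C) (z d : C) :
  is_derive F z d ->
  @filterdiff R_AbsRing C_R_NormedModule C_R_NormedModule F (locally z) (fun y => y * d).
Proof.
intros H. rewrite C_is_derive_eps in H. split.
- split.
  + intros x y. exact (Cmult_plus_distr_r x y d).
  + intros k x. change ((scal k x : C) * d = scal k (x * d)).
    rewrite !scal_R_Cmult. ring.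
  + exists (Cmod d + 1)%R. split; [pose proof (Cmod_ge_0 d); lra|].
    intros x. rewrite <- !Cmod_norm. rewrite Cmod_mult.
    pose proof (Cmod_ge_0 d). pose proof (Cmod_ge_0 x). nra.
- intros x Hx.
  assert (E : z = x) by exact (is_filter_lim_locally_unique (V := C_R_NormedModule) z x Hx).
  subst x. intros eps.
  destruct (H eps (cond_pos eps)) as (delta & Hp & Hd).
  apply locally_C. exists (mkposreal delta Hp). intros w Hw.
  specialize (Hd w Hw).
  rewrite <- !Cmod_norm. exact Hd.
Qed.

Lemma is_derive_path (F : C -> C) (p : R -> C) (t : R) (p' d : C) :
  is_derive p t p' -> is_derive F (p t) d ->
  is_derive (fun u => F (p u)) t (p' * d).
Proof.
intros Hp HF.
assert (K := filterdiff_comp' p F t _ _ Hp (filterdiff_C_R F (p t) d HF)).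
apply (filterdiff_ext_lin _ (fun y : R => (scal y p' : C) * d : C_R_NormedModule)); [exact K|].
intros y. rewrite !scal_R_Cmult. simpl. ring.
Qed.

Lemma is_derive_fst (p : R -> C) (t : R) (l : C) :
  is_derive p t l -> is_derive (fun u => fst (p u)) t (fst l).
Proof.
intros H.
exact (filterdiff_comp' p fst t _ _ H (filterdiff_linear (U := C_R_NormedModule) fst is_linear_fst)).
Qed.

Lemma is_derive_snd (p : R -> C) (t : R) (l : C) :
  is_derive p t l -> is_derive (fun u => snd (p u)) t (snd l).
Proof.
intros H.
exact (filterdiff_comp' p snd t _ _ H (filterdiff_linear (U := C_R_NormedModule) snd is_linear_snd)).
Qed.

Lemma continuous_Re {U : UniformSpace} (f : U -> C) (x : U) :
  continuous f x -> continuous (fun u => fst (f u)) x.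
Proof.
intros H. apply (continuous_comp f fst); [exact H|].
destruct (f x). apply continuous_fst.
Qed.

Definition cis (t : R) : C := (cos t, sin t).

Lemma Cmod_cis (t : R) : Cmod (cis t) = 1%R.
Proof.
unfold Cmod. rewrite <- sqrt_1. apply (f_equal sqrt).
change (cos t ^ 2 + sin t ^ 2 = 1)%R.
pose proof (sin2_cos2 t) as H. unfold Rsqr in H. lra.
Qed.

Lemma is_derive_cis (t : R) : is_derive cis t (Ci * cis t).
Proof.
replace (Ci * cis t) with ((- sin t, cos t)%R : C)
  by (apply injective_projections; unfold cis, Ci, Cmult; cbn [fst snd]; ring).
apply is_derive_pair; [apply is_derive_cos | apply is_derive_sin].
Qed.

Lemma continuous_cis (t : R) : continuous cis t.
Proof.
apply continuous_pair; [apply continuous_cos | apply continuous_sin].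
Qed.

Lemma continuous_RtoC {U : UniformSpace} (f : U -> R) (x : U) :
  continuous f x -> continuous (fun u => RtoC (f u)) x.
Proof.
intros H. apply continuous_pair; [exact H | apply continuous_const].
Qed.

Lemma in_disc_circle (s t : R) : (Rabs s < 1)%R -> in_disc (s * cis t).
Proof.
intros Hs. unfold in_disc. rewrite Cmod_mult, Cmod_cis, Cmod_R. lra.
Qed.

Lemma is_derive_RtoC (t : R) : is_derive RtoC t (RtoC 1).
Proof. exact (is_derive_pair _ _ t 1 0 (is_derive_id t) (is_derive_const 0%R t)). Qed.

Lemma C_is_derive_scal (c z : C) : is_derive (fun w => w * c) z c.
Proof.
apply C_is_derive_eps. intros eps He. exists 1%R. split; [lra|]. intros w _.
replace (w * c - z * c - (w - z) * c) with (RtoC 0) by ring.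
rewrite Cmod_0. pose proof (Cmod_ge_0 (w - z)). nra.
Qed.

Lemma is_derive_radial (F F' : C -> C) (s t : R) :
  (forall z, in_disc z -> is_derive F z (F' z)) -> (Rabs s < 1)%R ->
  is_derive (fun u : R => F (u * cis t)) s (cis t * F' (s * cis t)).
Proof.
intros HF Hs.
replace (cis t * F' (s * cis t)) with (1 * (cis t * F' (s * cis t))) by ring.
apply (is_derive_path (fun w => F (w * cis t)) RtoC); [apply is_derive_RtoC|].
apply C_is_derive_comp; [apply HF; now apply in_disc_circle | apply C_is_derive_scal].
Qed.

Lemma is_derive_angular (F F' : C -> C) (s t : R) :
  (forall z, in_disc z -> is_derive F z (F' z)) -> (Rabs s < 1)%R ->
  is_derive (fun u : R => F (s * cis u)) t (Ci * cis t * (s * F' (s * cis t))).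
Proof.
intros HF Hs.
apply (is_derive_path (fun w => F (s * w)) cis); [apply is_derive_cis|].
apply (C_is_derive_comp F (fun w => s * w)); [apply HF; now apply in_disc_circle|].
apply (is_derive_ext (fun w : C => w * s)); [intros w; apply Cmult_comm | apply C_is_derive_scal].
Qed.

Lemma continuous_circle_2d (F : C -> C) (s t : R) :
  (forall z, in_disc z -> continuous F z) -> (Rabs s < 1)%R ->
  continuous (fun p : R * R => cis (snd p) * F (fst p * cis (snd p))) (s, t).
Proof.
intros HF Hs.
assert (K : continuous (fun p : R * R => cis (snd p)) (s, t)).
{ apply (continuous_comp snd cis); [apply continuous_snd | apply continuous_cis]. }
apply continuous_Cmult; [exact K|].
apply (continuous_comp (fun p : R * R => fst p * cis (snd p)) F).
- apply continuous_Cmult; [|exact K].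
  apply continuous_RtoC. apply continuous_fst.
- apply HF. now apply in_disc_circle.
Qed.

(** The integral over the circle of radius [s] has [s]-derivative
    [∫ Re (cis t * F' (s * cis t)) dt]. The integrand is [1 / s] times the [t]-derivative of
    [Im F (s * cis t)], because [Im (Ci * w) = Re w], so it integrates to 0 over a full turn. The
    integral thus keeps its value at [s = 0]. *)
Lemma mean_value (F : C -> C) (r : R) :
  hol 1 F -> (0 < r < 1)%R ->
  RInt (fun t => fst (F (r * cis t))) 0 (2 * PI) = (2 * PI * fst (F 0))%R.
Proof.
intros HF Hr. pose proof (hol_pred 0 F HF) as HC.
destruct HF as (F' & HF & HF').
set (M := fun s : R => RInt (fun t => fst (F (s * cis t))) 0 (2 * PI)).
assert (Cont : forall s t, (Rabs s < 1)%R -> continuous (fun t : R => fst (F (s * cis t))) t).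
{ intros s t Hs. apply (continuous_Re (fun t => F (s * cis t))).
  apply (continuous_comp (fun t : R => s * cis t) F).
  - apply continuous_Cmult; [apply continuous_const | apply continuous_cis].
  - apply HC. now apply in_disc_circle. }
assert (Drad : forall s t, (Rabs s < 1)%R ->
  is_derive (fun u : R => fst (F (u * cis t))) s (fst (cis t * F' (s * cis t)))).
{ intros s t Hs. apply (is_derive_fst (fun u : R => F (u * cis t))).
  now apply is_derive_radial. }
assert (Near : forall s, (Rabs s < 1)%R -> locally s (fun u : R => (Rabs u < 1)%R)).
{ intros s Hs. assert (P : (0 < 1 - Rabs s)%R) by lra.
  assert (K : forall u, (Rabs (u - s) < 1 - Rabs s)%R -> (Rabs u < 1)%R).
  { intros u Hu. pose proof (Rabs_triang (u - s) s) as T.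
    replace (u - s + s)%R with u in T by ring. lra. }
  exists (mkposreal _ P). intros u Hu. exact (K u Hu). }
assert (DM : forall s, (Rabs s < 1)%R ->
  is_derive M s (RInt (fun t => fst (cis t * F' (s * cis t))) 0 (2 * PI))).
{ intros s Hs.
  replace (RInt (fun t => fst (cis t * F' (s * cis t))) 0 (2 * PI)) with
    (RInt (fun t => Derive (fun u : R => fst (F (u * cis t))) s) 0 (2 * PI)).
  - apply (is_derive_RInt_param (fun s t : R => fst (F (s * cis t)))).
    + apply (filter_imp (fun u : R => (Rabs u < 1)%R)); [|now apply Near].
      intros u Hu t _. eexists. now apply Drad.
    + intros t _.
      apply (continuity_2d_pt_ext_loc (fun u v => fst (cis v * F' (u * cis v)))).
      * destruct (Near s Hs) as [e He]. exists e. intros u v Hu _.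
        symmetry. apply is_derive_unique, Drad. apply He. exact Hu.
      * apply continuity_2d_pt_filterlim.
        apply (continuous_Re (fun p : R * R => cis (snd p) * F' (fst p * cis (snd p))) (s, t)).
        now apply continuous_circle_2d.
    + apply (filter_imp (fun u : R => (Rabs u < 1)%R)); [|now apply Near].
      intros u Hu. apply (ex_RInt_continuous (V := R_CompleteNormedModule)).
      intros t _. now apply Cont.
  - apply RInt_ext. intros t _. apply is_derive_unique. now apply Drad. }
assert (Zero : forall s, (0 < s < 1)%R ->
  RInt (fun t => fst (cis t * F' (s * cis t))) 0 (2 * PI) = 0%R).
{ intros s Hs. assert (Hs' : (Rabs s < 1)%R) by (rewrite Rabs_pos_eq; lra).
  apply is_RInt_unique.
  assert (E : scal (/ s)%R (minus (snd (F (s * cis (2 * PI)))) (snd (F (s * cis 0)))) = 0%R).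
  { unfold cis. rewrite cos_2PI, sin_2PI, cos_0, sin_0.
    rewrite minus_eq_zero. exact (scal_zero_r (/ s)%R). }
  refine (eq_ind _ (is_RInt _ 0 (2 * PI)) _ _ E).
  apply (is_RInt_ext (fun t => scal (/ s)%R (snd (Ci * cis t * (s * F' (s * cis t)))%C))).
  - intros t _. change (/ s * snd (Ci * cis t * (s * F' (s * cis t)))%C = fst (cis t * F' (s * cis t))%C)%R.
    unfold Cmult, Ci, RtoC. cbn [fst snd]. field. lra.
  - apply (is_RInt_scal (V := R_NormedModule)).
    apply (is_RInt_derive (V := R_CompleteNormedModule) (fun t => snd (F (s * cis t)))).
    + intros t _. apply (is_derive_snd (fun t : R => F (s * cis t))).
      now apply is_derive_angular.
    + intros t _.
      assert (K : continuous (fun t : R => F' (s * cis t)) t).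
      { apply (continuous_comp (fun t : R => s * cis t) F').
        - apply continuous_Cmult; [apply continuous_const | apply continuous_cis].
        - apply HF'. now apply in_disc_circle. }
      assert (K2 : continuous (fun t : R => Ci * cis t * (s * F' (s * cis t))) t).
      { apply (continuous_Cmult (fun t : R => Ci * cis t) (fun t : R => s * F' (s * cis t))).
        - apply (continuous_Cmult (fun _ : R => Ci) cis); [apply continuous_const | apply continuous_cis].
        - apply (continuous_Cmult (fun _ : R => RtoC s) (fun t : R => F' (s * cis t)));
            [apply continuous_const | exact K]. }
      apply (continuous_comp (fun t : R => Ci * cis t * (s * F' (s * cis t))) snd); [exact K2|].
      destruct (Ci * cis t * (s * F' (s * cis t))). apply continuous_snd. }
(* The derivative has to vanish only for [0 < s < r], where division by [s] is legitimate; at the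
   endpoints continuity is enough. *)
destruct (MVT_gen M 0 r (fun _ => 0%R)) as (c & _ & Hc).
- intros s. rewrite Rmin_left, Rmax_right by lra. intros Hs.
  rewrite <- (Zero s) by lra. apply DM. rewrite Rabs_pos_eq; lra.
- intros s. rewrite Rmin_left, Rmax_right by lra. intros Hs.
  apply continuity_pt_filterlim. apply (ex_derive_continuous M).
  eexists. apply DM. rewrite Rabs_pos_eq; lra.
- rewrite Rmult_0_l in Hc.
  change (M r = 2 * PI * fst (F 0))%R.
  replace (M r) with (M 0%R) by lra.
  unfold M. rewrite (RInt_ext _ (fun _ => fst (F 0))).
  + rewrite RInt_const. change ((2 * PI - 0) * fst (F 0) = 2 * PI * fst (F 0))%R. ring.
  + intros t _. now rewrite Cmult_0_l.
Qed.

(** A real part suffices for later modulus bounds: a factor conjugate to the value at the centre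
    turns that value into its squared modulus. *)
Lemma max_Re (F : C -> C) (r B : R) :
  hol 1 F -> (0 < r < 1)%R ->
  (forall z, Cmod z = r -> (fst (F z) <= B)%R) -> (fst (F 0) <= B)%R.
Proof.
intros HF Hr HB. pose proof PI_RGT_0 as HP.
assert (K : (RInt (fun t => fst (F (r * cis t)%C)) 0 (2 * PI) <= RInt (fun _ => B) 0 (2 * PI))%R).
{ apply RInt_le; [lra| |apply ex_RInt_const|].
  - apply (ex_RInt_continuous (V := R_CompleteNormedModule)). intros t _.
    apply (continuous_Re (fun t => F (r * cis t))).
    apply (continuous_comp (fun t : R => r * cis t) F).
    + apply continuous_Cmult; [apply continuous_const | apply continuous_cis].
    + apply (hol_continuous 1); [exact HF|]. apply in_disc_circle. rewrite Rabs_pos_eq; lra.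
  - intros t _. apply HB. rewrite Cmod_mult, Cmod_cis, Cmod_R, Rabs_pos_eq; lra. }
rewrite mean_value, RInt_const in K by assumption.
change (2 * PI * fst (F 0) <= (2 * PI - 0) * B)%R in K. nra.
Qed.

(** * Complex power series *)

Lemma is_pseries_C (c : nat -> C) (z l : C) :
  is_pseries c z l <-> is_series (fun n => z ^ n * c n) l.
Proof.
assert (E : forall n, @pow_n C_AbsRing z n = z ^ n).
{ intros n. induction n as [|n IH]; [reflexivity|]. simpl. now rewrite IH. }
unfold is_pseries. split; apply is_series_ext; intros n.
- exact (f_equal (fun x => x * c n) (E n)).
- exact (f_equal (fun x => x * c n) (eq_sym (E n))).
Qed.

Lemma is_series_Cmod_le (u : nat -> C) (v : nat -> R) (l : C) (s : R) :
  (forall n, (Cmod (u n) <= v n)%R) -> is_series u l -> is_series v s ->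
  (Cmod l <= s)%R.
Proof.
intros H Hu Hv.
assert (K : is_lim_seq (fun n => norm (sum_n u n)) (Cmod l)).
{ apply (filterlim_comp _ _ _ (sum_n u) norm _ (locally l)); [exact Hu|].
  exact (filterlim_norm (V := C_NormedModule) l). }
refine (is_lim_seq_le _ _ (Cmod l) s _ K Hv).
intros n. eapply Rle_trans; [apply (norm_sum_n_m (V := C_NormedModule))|].
apply sum_n_m_le. exact H.
Qed.

(** Convergence at the real point [(1 + rho) / 2] bounds the terms there, so the radius is at least
    that point, which exceeds [rho]. *)
Lemma CV_radius_disc (c : nat -> C) (rho : R) :
  (0 < rho < 1)%R ->
  (forall z, in_disc z -> exists l, is_pseries c z l) ->
  Rbar_lt rho (CV_radius (fun n => Cmod (c n))).
Proof.
intros Hr H.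
set (t := ((1 + rho) / 2)%R).
assert (Ht : in_disc t) by (unfold in_disc; rewrite Cmod_R, Rabs_pos_eq; unfold t; lra).
destruct (H t Ht) as [l Hl]. apply is_pseries_C in Hl.
destruct (filterlim_bounded _ (ex_intro _ l Hl)) as [M HM].
apply Rbar_lt_le_trans with t; [simpl; unfold t; lra|].
apply (proj1 (CV_radius_bounded (fun n => Cmod (c n)))).
(* A term is the difference of two consecutive partial sums, each bounded by [M]. *)
exists (M + M)%R. intros n.
assert (E : (Rabs (Cmod (c n) * t ^ n) = Cmod (t ^ n * c n)%C)%R).
{ rewrite Cmod_mult, Cmod_pow, Cmod_R, Rabs_mult, <- RPow_abs.
  rewrite (Rabs_pos_eq (Cmod (c n))) by apply Cmod_ge_0. ring. }
rewrite E. destruct n as [|n].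
- specialize (HM 0%nat). rewrite sum_O in HM.
  change (Cmod (t ^ 0 * c 0%nat)%C <= M)%R in HM. pose proof (Cmod_ge_0 (t ^ 0 * c 0%nat)). lra.
- pose proof (HM n) as H1. pose proof (HM (S n)) as H2. rewrite sum_Sn in H2.
  set (Sn := sum_n (fun n => t ^ n * c n) n : C) in *.
  set (X := t ^ S n * c (S n)) in *.
  change (Cmod Sn <= M)%R in H1. change (Cmod (Sn + X)%C <= M)%R in H2.
  pose proof (Cmod_triangle (Sn + X) (- Sn)) as T. rewrite Cmod_opp in T.
  replace (Sn + X + - Sn) with X in T by ring. lra.
Qed.

Lemma is_series_C_components (u : nat -> C) (l : C) :
  is_series u l -> l = (Series (fun n => fst (u n)), Series (fun n => snd (u n))).
Proof.
intros H.
assert (E1 : forall n, sum_n (fun n => fst (u n)) n = fst (sum_n u n : C)).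
{ induction n as [|n IH]; [now rewrite !sum_O|]. rewrite !sum_Sn, IH. reflexivity. }
assert (E2 : forall n, sum_n (fun n => snd (u n)) n = snd (sum_n u n : C)).
{ induction n as [|n IH]; [now rewrite !sum_O|]. rewrite !sum_Sn, IH. reflexivity. }
destruct l as [a b]. f_equal; symmetry; apply is_series_unique.
- apply (filterlim_ext (fun n => fst (sum_n u n : C))); [intros n; now rewrite E1|].
  apply (filterlim_comp _ _ _ (sum_n u) fst _ _ _ H). apply (continuous_fst a b).
- apply (filterlim_ext (fun n => snd (sum_n u n : C))); [intros n; now rewrite E2|].
  apply (filterlim_comp _ _ _ (sum_n u) snd _ _ _ H). apply (continuous_snd a b).
Qed.

Lemma is_series_C_unique (u : nat -> C) (l1 l2 : C) :
  is_series u l1 -> is_series u l2 -> l1 = l2.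
Proof.
intros H1 H2. now rewrite (is_series_C_components u l1 H1), (is_series_C_components u l2 H2).
Qed.

(** Built from the total real [Series], hence defined everywhere, but meaningful only where the
    complex series converges. *)
Definition CPSeries (c : nat -> C) (z : C) : C :=
  (Series (fun n => fst (z ^ n * c n)), Series (fun n => snd (z ^ n * c n))).

Lemma CPSeries_correct (c : nat -> C) (z : C) :
  (exists l, is_pseries c z l) -> is_pseries c z (CPSeries c z).
Proof.
intros [l Hl]. unfold CPSeries.
rewrite <- (is_series_C_components _ l); [exact Hl | now apply is_pseries_C].
Qed.

Definition C_PS_derive (c : nat -> C) (n : nat) : C := INR (S n) * c (S n).

Lemma ex_pseries_C_derive (c : nat -> C) :
  (forall z, in_disc z -> exists l, is_pseries c z l) ->
  forall z, in_disc z -> exists l, is_pseries (C_PS_derive c) z l.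
Proof.
intros H z Hz. unfold in_disc in Hz. pose proof (Cmod_ge_0 z) as Hz0.
set (rho := ((1 + Cmod z) / 2)%R).
assert (Hr : (0 < rho < 1)%R) by (unfold rho; lra).
pose proof (CV_radius_disc c rho Hr H) as R1.
rewrite <- CV_radius_derive in R1.
assert (R2 : Rbar_lt (Rabs rho) (CV_radius (PS_derive (fun n => Cmod (c n)))))
  by (rewrite Rabs_pos_eq by lra; exact R1).
apply CV_disk_inside in R2.
assert (Bd : forall n, (Cmod (z ^ n * C_PS_derive c n)
  <= Rabs (PS_derive (fun n => Cmod (c n)) n * rho ^ n))%R).
{ intros n. unfold PS_derive, C_PS_derive.
  pose proof (pos_INR (S n)) as PI. pose proof (Cmod_ge_0 (c (S n))) as PC.
  assert (PR : (0 <= rho ^ n)%R) by (apply pow_le; lra).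
  rewrite !Cmod_mult, Cmod_pow, Cmod_R, (Rabs_pos_eq (INR (S n))) by exact PI.
  rewrite Rabs_pos_eq by (repeat apply Rmult_le_pos; assumption).
  rewrite Rmult_comm. apply Rmult_le_compat_l; [now apply Rmult_le_pos|].
  apply pow_incr. unfold rho. lra. }
destruct (ex_series_le (V := C_CompleteNormedModule) _ _ Bd R2) as [l Hl].
exists l. now apply is_pseries_C.
Qed.

(* [INR n * z ^ (n - 1)], but [0] for [n = 0]. *)
Definition dCpow (z : C) (n : nat) : C :=
  match n with O => 0 | S m => INR (S m) * z ^ m end.

(** This is the second-order bound [n^2 rho^(n-2) |w - z|^2], multiplied by [rho^2] to keep the
    exponent natural. The remainder [E_n] satisfies [E_(n+1) = w E_n + (w - z)^2 dCpow z n], and the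
    induction closes because [n^2 + n <= (n + 1)^2]. *)
Lemma Cpow_taylor_bound (z w : C) (rho : R) (n : nat) :
  (0 < rho)%R -> (Cmod z <= rho)%R -> (Cmod w <= rho)%R ->
  (rho ^ 2 * Cmod (w ^ n - z ^ n - (w - z) * dCpow z n)
     <= INR n ^ 2 * rho ^ n * Cmod (w - z) ^ 2)%R.
Proof.
intros Hr Hz Hw. induction n as [|n IH].
- simpl dCpow. replace (w ^ 0 - z ^ 0 - (w - z) * 0) with (RtoC 0) by (simpl; ring).
  rewrite Cmod_0. simpl. lra.
- set (E := w ^ n - z ^ n - (w - z) * dCpow z n) in *.
  set (D := Cmod (w - z)) in *.
  assert (R : w ^ S n - z ^ S n - (w - z) * dCpow z (S n) = w * E + dCpow z n * ((w - z) * (w - z))).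
  { unfold E, dCpow. destruct n as [|n]; [simpl; ring|].
    rewrite (S_INR (S n)), RtoC_plus. simpl Cpow. ring. }
  rewrite R.
  assert (HD : (rho * Cmod (dCpow z n) <= INR n * rho ^ n)%R).
  { destruct n as [|n]; [simpl; rewrite Cmod_0; lra|].
    unfold dCpow. pose proof (pos_INR (S n)).
    rewrite Cmod_mult, Cmod_pow, Cmod_R, Rabs_pos_eq by assumption.
    replace (rho * (INR (S n) * Cmod z ^ n))%R with (INR (S n) * (rho * Cmod z ^ n))%R by ring.
    apply Rmult_le_compat_l; [assumption|]. simpl. apply Rmult_le_compat_l; [lra|].
    apply pow_incr. split; [apply Cmod_ge_0 | exact Hz]. }
  pose proof (Cmod_triangle (w * E) (dCpow z n * ((w - z) * (w - z)))) as T.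
  rewrite !Cmod_mult in T. fold D in T.
  assert (PD : (0 <= D ^ 2)%R) by apply pow2_ge_0.
  assert (PR : (0 <= rho ^ n)%R) by (apply pow_le; lra).
  pose proof (pos_INR n) as PN.
  assert (H1 : (rho ^ 2 * (Cmod w * Cmod E) <= rho * (INR n ^ 2 * rho ^ n * D ^ 2))%R).
  { replace (rho ^ 2 * (Cmod w * Cmod E))%R with (Cmod w * (rho ^ 2 * Cmod E))%R by ring.
    apply Rmult_le_compat; [apply Cmod_ge_0| |exact Hw|exact IH].
    apply Rmult_le_pos; [apply pow2_ge_0 | apply Cmod_ge_0]. }
  assert (H2 : (rho ^ 2 * (Cmod (dCpow z n) * (D * D)) <= rho * (INR n * rho ^ n * D ^ 2))%R).
  { replace (rho ^ 2 * (Cmod (dCpow z n) * (D * D)))%R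
      with (rho * (rho * Cmod (dCpow z n) * D ^ 2))%R by ring.
    apply Rmult_le_compat_l; [lra|]. apply Rmult_le_compat_r; assumption. }
  apply Rle_trans with (rho ^ 2 * (Cmod w * Cmod E + Cmod (dCpow z n) * (D * D)))%R.
  { apply Rmult_le_compat_l; [apply pow2_ge_0 | exact T]. }
  rewrite S_INR. simpl (rho ^ S n)%R.
  assert (H3 : (0 <= rho * rho ^ n * D ^ 2)%R) by (apply Rmult_le_pos; [apply Rmult_le_pos; lra | exact PD]).
  replace ((INR n + 1) ^ 2 * (rho * rho ^ n) * D ^ 2)%R
    with (rho * (INR n ^ 2 * rho ^ n * D ^ 2) + rho * (INR n * rho ^ n * D ^ 2)
          + (INR n + 1) * (rho * rho ^ n * D ^ 2))%R by ring.
  assert (H4 : (0 <= (INR n + 1) * (rho * rho ^ n * D ^ 2))%R) by (apply Rmult_le_pos; lra).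
  lra.
Qed.

(** Summing the second-order bounds of the powers gives [|F w - F z - (w - z) L| <= K |w - z|^2 /
    rho^2] with [K] the sum of [n^2 |c_n| rho^n]. *)
Lemma is_derive_CPSeries (c : nat -> C) (F : C -> C) (z : C) :
  (forall z, in_disc z -> is_pseries c z (F z)) -> in_disc z ->
  is_derive F z (CPSeries (C_PS_derive c) z).
Proof.
intros H Hz.
assert (Hex : forall z, in_disc z -> exists l, is_pseries c z l) by (intros x Hx; eexists; now apply H).
pose proof (CPSeries_correct _ z (ex_pseries_C_derive c Hex z Hz)) as HD.
set (L := CPSeries (C_PS_derive c) z) in *.
unfold in_disc in Hz. pose proof (Cmod_ge_0 z) as Hz0.
set (rho := ((1 + Cmod z) / 2)%R).
assert (Hr : (0 < rho < 1)%R) by (unfold rho; lra).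
assert (Hzr : (Cmod z < rho)%R) by (unfold rho; lra).
(* The operator [x d/dx] multiplies the n-th coefficient by [n] and keeps the radius of convergence;
   applied twice, it shows that [K] is finite. *)
set (xD := fun a : nat -> R => PS_incr_1 (PS_derive a)).
set (A := fun n => Cmod (c n)).
assert (R2 : Rbar_lt (Rabs rho) (CV_radius (xD (xD A)))).
{ unfold xD. rewrite CV_radius_incr_1, CV_radius_derive, CV_radius_incr_1, CV_radius_derive.
  rewrite Rabs_pos_eq by lra. now apply CV_radius_disc. }
apply CV_disk_inside in R2. destruct R2 as [K HK].
assert (ExD : forall n, xD (xD A) n = (INR n ^ 2 * A n)%R).
{ intros [|n].
  - change (0 = INR 0 ^ 2 * A 0%nat)%R. simpl (INR 0). ring.
  - change (INR (S n) * (INR (S n) * A (S n)) = INR (S n) ^ 2 * A (S n))%R. ring. }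
assert (PA : forall n, (0 <= INR n ^ 2 * A n * rho ^ n)%R).
{ intros n. apply Rmult_le_pos; [apply Rmult_le_pos|]; [apply pow2_ge_0 | apply Cmod_ge_0|].
  apply pow_le; lra. }
apply (is_series_ext _ (fun n => INR n ^ 2 * A n * rho ^ n)%R) in HK.
2: { intros n. rewrite ExD. now apply Rabs_pos_eq. }
assert (HKpos : (0 <= K)%R).
{ pose proof (is_series_unique _ _ HK) as U. rewrite <- U.
  apply Rle_trans with (Series (fun _ => 0)%R); [right; symmetry; apply is_series_unique|].
  - apply filterlim_ext with (fun _ : nat => 0%R); [|apply filterlim_const].
    intros n. induction n as [|n IH]; [now rewrite sum_O|].
    rewrite sum_Sn, <- IH. unfold plus; simpl; ring.
  - apply Series_le; [|now exists K]. intros n. split; [lra | apply PA]. }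
apply C_is_derive_eps. intros eps He.
(* [K] may be 0, hence the denominator [K + 1]. *)
assert (P1 : (0 < eps * rho ^ 2 / (K + 1))%R).
{ apply Rdiv_lt_0_compat; [|lra]. apply Rmult_lt_0_compat; [lra|]. apply pow_lt; lra. }
exists (Rmin (rho - Cmod z) (eps * rho ^ 2 / (K + 1)))%R.
split; [apply Rmin_pos; lra|].
intros w Hw.
assert (Hw1 : (Cmod (w - z) < rho - Cmod z)%R) by (eapply Rlt_le_trans; [exact Hw|apply Rmin_l]).
assert (Hw2 : (Cmod (w - z) < eps * rho ^ 2 / (K + 1))%R) by (eapply Rlt_le_trans; [exact Hw|apply Rmin_r]).
assert (Hwr : (Cmod w <= rho)%R).
{ pose proof (Cmod_triangle (w - z) z) as T. replace (w - z + z) with w in T by ring. lra. }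
assert (Sw := proj1 (is_pseries_C _ _ _) (H w ltac:(unfold in_disc; lra))).
assert (Sz := proj1 (is_pseries_C _ _ _) (H z ltac:(unfold in_disc; lra))).
assert (Sd : is_series (fun n => dCpow z n * c n) L).
{ apply (is_series_decr_1 (V := C_NormedModule)). apply is_pseries_C in HD.
  assert (E : plus L (opp (dCpow z 0 * c 0%nat)) = L)
    by (change (L + - (0 * c 0%nat) = L); ring).
  refine (eq_ind_r (is_series (V := C_NormedModule) _) _ E).
  revert HD. apply is_series_ext. intros n. unfold C_PS_derive, dCpow.
  change (z ^ n * (INR (S n) * c (S n)) = INR (S n) * z ^ n * c (S n)). ring. }
assert (SE : is_series (fun n => (w ^ n - z ^ n - (w - z) * dCpow z n) * c n) (F w - F z - (w - z) * L)).
{ pose proof (is_series_minus _ _ _ _ (is_series_minus _ _ _ _ Sw Sz)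
    (is_series_scal_l (w - z) _ _ Sd)) as S0.
  revert S0. apply is_series_ext. intros n.
  change (w ^ n * c n + - (z ^ n * c n) + - ((w - z) * (dCpow z n * c n))
    = (w ^ n - z ^ n - (w - z) * dCpow z n) * c n). ring. }
pose proof (is_series_scal_r (Cmod (w - z) ^ 2 / rho ^ 2)%R _ _ HK) as SK.
assert (P2 : (0 < rho ^ 2)%R) by (apply pow_lt; lra).
assert (B1 : (Cmod (F w - F z - (w - z) * L) <= K * (Cmod (w - z) ^ 2 / rho ^ 2))%R).
{ refine (is_series_Cmod_le _ _ _ _ _ SE SK).
  intros n. cbv beta. rewrite Cmod_mult.
  apply Rmult_le_reg_l with (rho ^ 2)%R; [exact P2|].
  pose proof (Cpow_taylor_bound z w rho n ltac:(lra) ltac:(lra) Hwr) as T.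
  replace (rho ^ 2 * (INR n ^ 2 * A n * rho ^ n * (Cmod (w - z) ^ 2 / rho ^ 2)))%R
    with (INR n ^ 2 * rho ^ n * Cmod (w - z) ^ 2 * A n)%R by (field; lra).
  rewrite <- Rmult_assoc. apply Rmult_le_compat_r; [apply Cmod_ge_0 | exact T]. }
eapply Rle_trans; [exact B1|].
set (D := Cmod (w - z)) in *. assert (PD : (0 <= D)%R) by apply Cmod_ge_0.
replace (K * (D ^ 2 / rho ^ 2))%R with (K * D / rho ^ 2 * D)%R by (field; lra).
apply Rmult_le_compat_r; [exact PD|].
apply Rmult_le_reg_r with (rho ^ 2)%R; [exact P2|].
replace (K * D / rho ^ 2 * rho ^ 2)%R with (K * D)%R by (field; lra).
apply Rle_trans with ((K + 1) * (eps * rho ^ 2 / (K + 1)))%R.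
- apply Rmult_le_compat; lra.
- right. field. lra.
Qed.

Lemma hol_pseries (n : nat) (c : nat -> C) (F : C -> C) :
  (forall z, in_disc z -> is_pseries c z (F z)) -> hol n F.
Proof.
revert c F. induction n as [|n IH]; intros c F H.
- intros z Hz. exact (C_is_derive_continuous _ _ _ (is_derive_CPSeries c F z H Hz)).
- exists (CPSeries (C_PS_derive c)). split.
  + intros z Hz. now apply is_derive_CPSeries.
  + apply (IH (C_PS_derive c)). intros z Hz. apply CPSeries_correct.
    apply ex_pseries_C_derive; [|exact Hz]. intros x Hx. exists (F x). now apply H.
Qed.

(** * Schwarz-type inequalities *)

Lemma le_at_1 (u v : R -> R) :
  continuous u 1%R -> continuous v 1%R ->
  (forall r, (0 < r < 1)%R -> (u r <= v r)%R) -> (u 1 <= v 1)%R.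
Proof.
intros Hu Hv H.
assert (F : at_left 1 (fun r => (u r <= v r)%R)).
{ exists (mkposreal 1 Rlt_0_1). intros r Hr Hr1.
  assert (K : (Rabs (r - 1) < 1)%R) by exact Hr. apply Rabs_def2 in K.
  apply H. split; [|exact Hr1].
  destruct K as [_ K]. revert K. intros K. lra. }
refine (filterlim_le (F := at_left 1) u v (u 1%R) (v 1%R) F _ _).
- intros P HP. unfold filtermap, at_left, within.
  apply (filter_imp (fun r => P (u r))); [auto | exact (Hu P HP)].
- intros P HP. unfold filtermap, at_left, within.
  apply (filter_imp (fun r => P (v r))); [auto | exact (Hv P HP)].
Qed.

Lemma Re_le_Cmod (z : C) : (fst z <= Cmod z)%R.
Proof. pose proof (re_le_Cmod z). pose proof (Rle_abs (Re z)). unfold Re in *. lra. Qed.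

Lemma Cconj_mult_self (z : C) : Cconj z * z = RtoC (Cmod z ^ 2).
Proof. rewrite Cmod2_conj. ring. Qed.

(** The exact amount by which the automorphism [(z + w) / (1 + Cconj w * z)] falls short of modulus
    1. It serves both to transport an interior point to the centre and in the Schwarz-Pick
    estimate. *)
Lemma moebius_identity (z w : C) :
  (Cmod (z + w) ^ 2 =
   Cmod (1 + Cconj w * z) ^ 2 - (1 - Cmod z ^ 2) * (1 - Cmod w ^ 2))%R.
Proof.
rewrite !Cmod2_alt. destruct z as [x y], w as [a b].
unfold Re, Im, Cmult, Cplus, Cconj, RtoC. cbn [fst snd]. ring.
Qed.

(** The hypothesis gives [|H| <= 1 / |z|^2], which is good only near the unit circle. The
    automorphism [T] with [T 0 = z0] keeps small circles' images away from consideration: as [r]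
    tends to 1, the image of [|z| = r] approaches the unit circle. Bounding
    [Re (Cconj (H z0) * H (T z))] there yields [h^2 <= h / tau r], and in the limit [h^2 <= h]. *)
Lemma max_modulus (H : C -> C) :
  hol 1 H -> (forall z, in_disc z -> (Cmod (z ^ 2 * H z) <= 1)%R) ->
  forall z, in_disc z -> (Cmod (H z) <= 1)%R.
Proof.
intros HH HB z0 Hz0. unfold in_disc in Hz0.
set (s := Cmod z0) in *. assert (Hs : (0 <= s)%R) by apply Cmod_ge_0.
set (h := Cmod (H z0)). assert (Hh : (0 <= h)%R) by apply Cmod_ge_0.
assert (Den : forall z, in_disc z -> (1 - s <= Cmod (1 + Cconj z0 * z))%R).
{ intros z Hz. unfold in_disc in Hz.
  pose proof (Cmod_triangle (1 + Cconj z0 * z) (- (Cconj z0 * z))) as T.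
  replace (1 + Cconj z0 * z + - (Cconj z0 * z)) with (RtoC 1) in T by ring.
  rewrite Cmod_1, Cmod_opp, Cmod_mult, Cmod_conj in T. fold s in T.
  pose proof (Cmod_ge_0 z). nra. }
assert (Den0 : forall z, in_disc z -> 1 + Cconj z0 * z <> 0).
{ intros z Hz. apply Cmod_gt_0. specialize (Den z Hz). lra. }
set (T := fun z => (z + z0) * / (1 + Cconj z0 * z)).
assert (ModT : forall z, in_disc z ->
  (Cmod (T z) ^ 2 * Cmod (1 + Cconj z0 * z) ^ 2
   = Cmod (1 + Cconj z0 * z) ^ 2 - (1 - Cmod z ^ 2) * (1 - s ^ 2))%R).
{ intros z Hz. unfold s. rewrite <- moebius_identity. unfold T.
  rewrite <- Rpow_mult_distr, <- Cmod_mult. f_equal. f_equal. field. now apply Den0. }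
assert (DT : forall z, in_disc z -> in_disc (T z)).
{ intros z Hz. pose proof (ModT z Hz) as E. pose proof (Den z Hz) as D.
  unfold in_disc in *. pose proof (Cmod_ge_0 (T z)). pose proof (Cmod_ge_0 z).
  set (q := Cmod (1 + Cconj z0 * z)) in *. set (t := Cmod (T z)) in *. set (r := Cmod z) in *.
  assert (0 < (1 - r ^ 2) * (1 - s ^ 2))%R by (apply Rmult_lt_0_compat; nra).
  assert (0 < q ^ 2)%R by (apply pow_lt; lra).
  destruct (Rlt_or_le t 1) as [L|L]; [exact L|].
  assert (1 <= t ^ 2)%R by nra. nra. }
assert (HT : hol 1 T).
{ apply hol_mult; [apply hol_plus; [apply hol_id | apply hol_const]|].
  apply hol_inv; [exact Den0|].
  apply hol_plus; [apply hol_const | apply hol_mult; [apply hol_const | apply hol_id]]. }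
(* A lower bound for [|T z|^2] on [|z| = r], from the Möbius identity and
   [|1 + Cconj z0 * z| >= 1 - s]; it equals 1 at [r = 1]. Where it is not positive the claimed
   inequality is trivial. *)
set (tau := fun r : R => (1 - (1 - r ^ 2) * ((1 - s ^ 2) / (1 - s) ^ 2))%R).
assert (K : (tau 1 * h ^ 2 <= h)%R).
{ apply (le_at_1 (fun r => tau r * h ^ 2)%R (fun _ => h)).
  - apply (ex_derive_continuous (fun r => tau r * h ^ 2)%R). unfold tau. auto_derive. exact I.
  - apply continuous_const.
  - intros r Hr. destruct (Rle_or_lt (tau r) 0) as [L|L]; [pose proof (pow2_ge_0 h); nra|].
    assert (B : (fst (Cconj (H z0) * H (T 0))%C <= h / tau r)%R).
    { apply (max_Re (fun z => Cconj (H z0) * H (T z)) r); [|exact Hr|].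
      - apply hol_mult; [apply hol_const|]. now apply hol_comp.
      - intros z Hz. eapply Rle_trans; [apply Re_le_Cmod|].
        rewrite Cmod_mult, Cmod_conj. fold h. apply Rmult_le_compat_l; [exact Hh|].
        assert (Dz : in_disc z) by (unfold in_disc; lra).
        pose proof (HB (T z) (DT z Dz)) as B. rewrite Cmod_mult, Cmod_pow in B.
        assert (TT : (tau r <= Cmod (T z) ^ 2)%R).
        { pose proof (ModT z Dz) as E. pose proof (Den z Dz) as D. rewrite Hz in E.
          set (q := Cmod (1 + Cconj z0 * z)) in *. set (t := Cmod (T z)) in *.
          assert (Q : (0 < (1 - s) ^ 2)%R) by (apply pow_lt; lra).
          assert (Q2 : ((1 - s) ^ 2 <= q ^ 2)%R) by (apply pow_incr; lra).
          assert (X : (0 <= (1 - r ^ 2) * (1 - s ^ 2))%R) by (apply Rmult_le_pos; nra).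
          apply Rmult_le_reg_r with (q ^ 2)%R; [lra|]. rewrite E. unfold tau.
          assert (Y : ((1 - r ^ 2) * (1 - s ^ 2) <= (1 - r ^ 2) * ((1 - s ^ 2) / (1 - s) ^ 2) * q ^ 2)%R).
          { replace ((1 - r ^ 2) * ((1 - s ^ 2) / (1 - s) ^ 2) * q ^ 2)%R
              with ((1 - r ^ 2) * (1 - s ^ 2) * (q ^ 2 / (1 - s) ^ 2))%R by (field; lra).
            rewrite <- (Rmult_1_r ((1 - r ^ 2) * (1 - s ^ 2))) at 1.
            apply Rmult_le_compat_l; [exact X|].
            apply Rmult_le_reg_r with ((1 - s) ^ 2)%R; [exact Q|].
            replace (q ^ 2 / (1 - s) ^ 2 * (1 - s) ^ 2)%R with (q ^ 2)%R by (field; lra). lra. }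
          lra. }
        apply Rmult_le_reg_l with (tau r); [exact L|]. rewrite Rinv_r by lra.
        pose proof (Cmod_ge_0 (H (T z))). nra. }
    assert (T0 : T 0 = z0).
    { unfold T. rewrite Cmult_0_r, Cplus_0_l, Cplus_0_r. field. }
    rewrite T0, Cconj_mult_self in B. fold h in B. change (h ^ 2 <= h / tau r)%R in B.
    apply (Rmult_le_compat_l (tau r)) in B; [|lra].
    replace (tau r * (h / tau r))%R with h in B by (field; lra). exact B. }
unfold tau in K. nra.
Qed.

(** On [|z| = r] one has [|H|^2 = S + Re W + |z^3 E|^2] with [W] holomorphic and [W 0 = 0]. Hence
    [Re W <= 1 - S] on the circle, and the value at the centre gives [0 <= 1 - S]; then [r] tends to
    1. *)
Lemma bessel3 (E : C -> C) (d0 d1 d2 : C) :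
  hol 1 E ->
  (forall z, in_disc z -> (Cmod (d0 + d1 * z + d2 * z ^ 2 + z ^ 3 * E z) <= 1)%R) ->
  (Cmod d0 ^ 2 + Cmod d1 ^ 2 + Cmod d2 ^ 2 <= 1)%R.
Proof.
intros HE HB.
replace (Cmod d0 ^ 2 + Cmod d1 ^ 2 + Cmod d2 ^ 2)%R
  with (Cmod d0 ^ 2 + Cmod d1 ^ 2 * 1 ^ 2 + Cmod d2 ^ 2 * 1 ^ 4)%R by ring.
apply (le_at_1 (fun r => Cmod d0 ^ 2 + Cmod d1 ^ 2 * r ^ 2 + Cmod d2 ^ 2 * r ^ 4)%R (fun _ => 1%R)).
- apply (ex_derive_continuous
    (fun r => Cmod d0 ^ 2 + Cmod d1 ^ 2 * r ^ 2 + Cmod d2 ^ 2 * r ^ 4)%R).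
  auto_derive. exact I.
- apply continuous_const.
- intros r Hr.
  set (S := (Cmod d0 ^ 2 + Cmod d1 ^ 2 * r ^ 2 + Cmod d2 ^ 2 * r ^ 4)%R).
  (* Twice the cross terms of [Cconj H * H]: from each conjugate pair the one with the higher power
     of [z] unconjugated is kept, and [Cconj z * z = r^2] removes [Cconj z]. A positive power of [z]
     always survives, so [W 0 = 0]. *)
  set (W := fun z => 2 * (Cconj d0 * d1 * z + Cconj d0 * d2 * z ^ 2 + Cconj d1 * d2 * (r ^ 2)%R * z
    + (Cconj d0 * z ^ 3 + Cconj d1 * (r ^ 2)%R * z ^ 2 + Cconj d2 * (r ^ 4)%R * z) * E z)).
  assert (K : (fst (W 0) <= 1 - S)%R).
  { apply (max_Re W r); [|exact Hr|].
    - unfold W. hol_auto.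
    - intros z Hz. set (X := z ^ 3 * E z).
      assert (Dz : in_disc z) by (unfold in_disc; lra).
      pose proof (HB z Dz) as B.
      set (H := d0 + d1 * z + d2 * z ^ 2 + X). change (Cmod H <= 1)%R in B.
      assert (Hc : Cconj z * z = (r ^ 2)%R) by (rewrite Cconj_mult_self, Hz; reflexivity).
      assert (Id : RtoC (Cmod H ^ 2) = S + (W z + Cconj (W z)) / 2 + (Cmod X ^ 2)%R).
      { rewrite <- Cconj_mult_self. rewrite <- (Cconj_mult_self X).
        unfold S. rewrite !RtoC_plus, !RtoC_mult.
        replace (RtoC (r ^ 4)) with ((r ^ 2)%R * (r ^ 2)%R : C) by (rewrite <- RtoC_mult; f_equal; ring).
        unfold W. 
        replace (RtoC (r ^ 4)) with ((r ^ 2)%R * (r ^ 2)%R : C) by (rewrite <- RtoC_mult; f_equal; ring).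
        rewrite <- !Cconj_mult_self, <- Hc. unfold H, X.
        repeat rewrite ?Cplus_conj, ?Cmult_conj, ?Cpow_conj, ?Cconj_conj.
        replace (Cconj 2) with (RtoC 2) by (unfold Cconj, RtoC; simpl; f_equal; ring).
        field. }
      assert (B2 : (Cmod H ^ 2 <= 1)%R) by (pose proof (Cmod_ge_0 H); nra).
      pose proof (pow2_ge_0 (Cmod X)).
      rewrite <- re_alt in Id. rewrite <- !RtoC_plus in Id. apply RtoC_inj in Id.
      change (Re (W z) <= 1 - S)%R. lra. }
  replace (W 0) with (RtoC 0) in K by (unfold W; ring). simpl in K. lra.
Qed.

(** With [N = (H - d0) / z], the quotient [N / (1 - Cconj d0 * H)] is at most [1 / r] in modulus on
    [|z| = r] by the Möbius identity, and its value at 0 is [d1 / (1 - |d0|^2)]. *)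
Lemma schwarz_pick0 (E : C -> C) (d0 d1 d2 : C) :
  hol 1 E ->
  (forall z, in_disc z -> (Cmod (d0 + d1 * z + d2 * z ^ 2 + z ^ 3 * E z) <= 1)%R) ->
  (Cmod d1 <= 1 - Cmod d0 ^ 2)%R.
Proof.
intros HE HB.
pose proof (bessel3 E d0 d1 d2 HE HB) as Bes.
set (x := Cmod d0) in *. set (y := Cmod d1) in *.
assert (Hx : (0 <= x)%R) by apply Cmod_ge_0. assert (Hy : (0 <= y)%R) by apply Cmod_ge_0.
assert (Hd2 : (0 <= Cmod d2 ^ 2)%R) by apply pow2_ge_0.
(* If [|d0| >= 1], Bessel's inequality forces [|d0| = 1] and [d1 = 0]. *)
destruct (Rlt_or_le x 1) as [L|L]; [|nra].
set (H := fun z => d0 + d1 * z + d2 * z ^ 2 + z ^ 3 * E z).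
set (N := fun z => d1 + d2 * z + z ^ 2 * E z).
assert (Den : forall z, in_disc z -> 1 - Cconj d0 * H z <> 0).
{ intros z Hz. apply Cmod_gt_0.
  pose proof (Cmod_triangle (1 - Cconj d0 * H z) (Cconj d0 * H z)) as T.
  replace (1 - Cconj d0 * H z + Cconj d0 * H z) with (RtoC 1) in T by ring.
  rewrite Cmod_1, Cmod_mult, Cmod_conj in T. fold x in T.
  pose proof (HB z Hz : (Cmod (H z) <= 1)%R). pose proof (Cmod_ge_0 (H z)). nra. }
assert (K : (y ^ 2 * 1 <= y * (1 - x ^ 2))%R).
{ apply (le_at_1 (fun r => y ^ 2 * r)%R (fun _ => y * (1 - x ^ 2))%R).
  - apply (ex_derive_continuous (fun r => y ^ 2 * r)%R). auto_derive. exact I.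
  - apply continuous_const.
  - intros r Hr.
    assert (B : (fst (Cconj d1 * N 0 * / (1 - Cconj d0 * H 0))%C <= y / r)%R).
    { apply (max_Re (fun z => Cconj d1 * N z * / (1 - Cconj d0 * H z)) r); [|exact Hr|].
      - apply hol_mult; [unfold N; hol_auto|]. apply hol_inv; [exact Den|]. unfold H. hol_auto.
      - intros z Hz. eapply Rle_trans; [apply Re_le_Cmod|].
        assert (Dz : in_disc z) by (unfold in_disc; lra).
        pose proof (Den z Dz) as Q. pose proof (HB z Dz : (Cmod (H z) <= 1)%R) as HH.
        assert (QP : (0 < Cmod (1 - Cconj d0 * H z))%R) by now apply Cmod_gt_0.
        rewrite !Cmod_mult, Cmod_conj, Cmod_inv by exact Q. fold y.
        assert (R : (r * Cmod (N z) <= Cmod (1 - Cconj d0 * H z))%R).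
        { rewrite <- Hz, <- Cmod_mult.
          replace (z * N z) with (H z + - d0) by (unfold H, N; ring).
          pose proof (moebius_identity (H z) (- d0)) as MI.
          rewrite Cmod_opp in MI. fold x in MI.
          replace (1 + Cconj (- d0) * H z) with (1 - Cconj d0 * H z) in MI
            by (rewrite Copp_conj; ring).
          pose proof (Cmod_ge_0 (H z)).
          assert (0 <= (1 - Cmod (H z) ^ 2) * (1 - x ^ 2))%R by (apply Rmult_le_pos; nra).
          pose proof (Cmod_ge_0 (H z + - d0)). nra. }
        rewrite Rmult_assoc. apply Rmult_le_compat_l; [exact Hy|].
        apply Rmult_le_reg_l with (r * Cmod (1 - Cconj d0 * H z))%R; [apply Rmult_lt_0_compat; lra|].
        replace (r * Cmod (1 - Cconj d0 * H z) * (Cmod (N z) * / Cmod (1 - Cconj d0 * H z)))%R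
          with (r * Cmod (N z))%R by (field; lra).
        replace (r * Cmod (1 - Cconj d0 * H z) * / r)%R with (Cmod (1 - Cconj d0 * H z)) by (field; lra).
        exact R. }
    assert (E0 : Cconj d1 * N 0 * / (1 - Cconj d0 * H 0) = (y ^ 2 / (1 - x ^ 2))%R).
    { replace (N 0) with d1 by (unfold N; ring). replace (H 0) with d0 by (unfold H; ring).
      rewrite !Cconj_mult_self. fold x y. rewrite RtoC_div, RtoC_minus; [reflexivity|nra]. }
    rewrite E0 in B. change (y ^ 2 / (1 - x ^ 2) <= y / r)%R in B.
    assert (X : (0 < 1 - x ^ 2)%R) by nra.
    apply (Rmult_le_compat_l (r * (1 - x ^ 2))) in B; [|nra].
    replace (r * (1 - x ^ 2) * (y ^ 2 / (1 - x ^ 2)))%R with (y ^ 2 * r)%R in B by (field; lra).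
    replace (r * (1 - x ^ 2) * (y / r))%R with (y * (1 - x ^ 2))%R in B by (field; lra).
    exact B. }
destruct (Req_dec y 0) as [Z|Z]; [rewrite Z; nra|]. nra.
Qed.

(** Since [t * k (t * z)] has [t]-derivative [(k + z k') (t * z)], the value [k z] is a mean of
    [k + z k'] along the radius. Pairing with [Cconj (k z)] makes this real, and the mean value
    theorem gives [h^2 <= h] without an integral. *)
Lemma radial_mean_bound (k k' : C -> C) :
  (forall z, in_disc z -> is_derive k z (k' z)) ->
  (forall z, in_disc z -> (Cmod (k z + z * k' z) <= 1)%R) ->
  forall z, in_disc z -> (Cmod (k z) <= 1)%R.
Proof.
intros Hk HB z Hz. set (h := Cmod (k z)). assert (Hh : (0 <= h)%R) by apply Cmod_ge_0.
assert (Dt : forall t : R, (0 <= t <= 1)%R -> in_disc (t * z)).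
{ intros t Ht. unfold in_disc in *. rewrite Cmod_mult, Cmod_R, Rabs_pos_eq by lra.
  pose proof (Cmod_ge_0 z). nra. }
set (q := fun t : R => fst (t * (Cconj (k z) * k (t * z)))).
set (q' := fun t : R => fst (Cconj (k z) * (k (t * z) + t * z * k' (t * z)))).
assert (Dq : forall t, (0 <= t <= 1)%R -> is_derive q t (q' t)).
{ intros t Ht. unfold q'.
  replace (Cconj (k z) * (k (t * z) + t * z * k' (t * z)))
    with (RtoC 1 * (1 * (Cconj (k z) * k (t * z)) + t * (0 * k (t * z) + Cconj (k z) * (z * k' (t * z))))) by ring.
  apply (is_derive_fst (fun t : R => t * (Cconj (k z) * k (t * z)))).
  apply (is_derive_path (fun w => w * (Cconj (k z) * k (w * z))) RtoC); [apply is_derive_RtoC|].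
  apply (C_is_derive_mult (fun w => w) (fun w => Cconj (k z) * k (w * z)) t 1); [apply C_is_derive_id|].
  apply (C_is_derive_mult (fun _ => Cconj (k z)) (fun w => k (w * z)) t 0); [exact (is_derive_const (Cconj (k z)) (RtoC t))|].
  apply (C_is_derive_comp k (fun w => w * z)); [apply Hk; now apply Dt | apply C_is_derive_scal]. }
destruct (MVT_gen q 0 1 q') as (c & Hc & E).
- intros t. rewrite Rmin_left, Rmax_right by lra. intros Ht. apply Dq. lra.
- intros t. rewrite Rmin_left, Rmax_right by lra. intros Ht.
  apply continuity_pt_filterlim. apply (ex_derive_continuous q). eexists. now apply Dq.
- rewrite Rmin_left, Rmax_right in Hc by lra.
  assert (E0 : q 0%R = 0%R) by (unfold q; rewrite Cmult_0_l; reflexivity).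
  assert (E1 : q 1%R = (h ^ 2)%R) by (unfold q; rewrite !Cmult_1_l, Cconj_mult_self; reflexivity).
  assert (B : (q' c <= h)%R).
  { unfold q'. eapply Rle_trans; [apply Re_le_Cmod|].
    rewrite Cmod_mult, Cmod_conj. fold h. pose proof (HB (c * z) (Dt c Hc)).
    pose proof (Cmod_ge_0 (k (c * z) + c * z * k' (c * z))). nra. }
  nra.
Qed.

(** Inversion maps a disc whose boundary passes through 0 to a half-plane: the hypothesis expands to
    [|g|^2 <= 2 Re (A * Cconj g)]. *)
Lemma Re_div_half_plane (A g : C) :
  g <> 0 -> (Cmod (g - A) <= Cmod A)%R -> (1 / 2 <= fst (A / g)%C)%R.
Proof.
intros Hg HA.
assert (G : (0 < Cmod g ^ 2)%R) by (apply pow_lt; now apply Cmod_gt_0).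
assert (K : (Cmod (g - A) ^ 2 <= Cmod A ^ 2)%R) by (apply pow_incr; split; [apply Cmod_ge_0 | exact HA]).
rewrite !Cmod2_alt in *. destruct A as [a b], g as [x y].
unfold Re, Im, Cminus, Copp, Cplus, Cdiv, Cmult, Cinv in *. cbn [fst snd] in *.
replace (a * (x / (x ^ 2 + y ^ 2)) - b * (- y / (x ^ 2 + y ^ 2)))%R
  with ((a * x + b * y) / (x ^ 2 + y ^ 2))%R by (field; lra).
apply Rmult_le_reg_r with (x ^ 2 + y ^ 2)%R; [exact G|].
replace ((a * x + b * y) / (x ^ 2 + y ^ 2) * (x ^ 2 + y ^ 2))%R with (a * x + b * y)%R by (field; lra).
nra.
Qed.

(** * The class U *)

Definition pconv (c : nat -> C) (F : C -> C) : Prop :=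
  forall z, in_disc z -> is_pseries c z (F z).

(** Iterated, this gives finite Taylor expansions whose remainder is again a power series, hence
    smooth also at 0. Dividing by [z] fails at 0, so that point is treated apart. *)
Lemma pconv_shift (c : nat -> C) (F : C -> C) :
  pconv c F -> exists G, pconv (fun n => c (S n)) G /\
    forall z, in_disc z -> F z = c 0%nat + z * G z.
Proof.
intros H.
assert (Zero : forall b : nat -> C, is_pseries b (RtoC 0) (b 0%nat)) by (intros b; exact (is_pseries_0 b)).
assert (Ex : forall z, in_disc z -> exists l, is_pseries (fun n => c (S n)) z l).
{ intros z Hz. destruct (Ceq_dec z 0) as [->|Nz]; [exists (c 1%nat); apply Zero|].
  eexists. apply (is_pseries_decr_1 c z (/ z) (F z)); [|now apply H].
  exact (Cinv_l z Nz). }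
exists (CPSeries (fun n => c (S n))). split; [intros z Hz; apply CPSeries_correct; auto|].
intros z Hz. destruct (Ceq_dec z 0) as [->|Nz].
- rewrite (is_series_C_unique _ _ _ (H 0 Hz) (Zero c)). ring.
- pose proof (is_pseries_decr_1 c z (/ z) (F z) (Cinv_l z Nz) (H z Hz)) as S1.
  pose proof (CPSeries_correct _ _ (Ex z Hz)) as S2.
  rewrite (is_series_C_unique _ _ _ S2 S1).
  change (F z = c 0%nat + z * (/ z * (F z + - c 0%nat))). field. exact Nz.
Qed.

Lemma is_derive_horner (c : C) (F : C -> C) (z d : C) :
  is_derive F z d -> is_derive (fun w => c + w * F w) z (F z + z * d).
Proof.
intros H.
replace (F z + z * d) with (0 + (1 * F z + z * d)) by ring.
apply (C_is_derive_plus (fun _ => c)); [exact (is_derive_const c z)|].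
apply (C_is_derive_mult (fun w => w) F z 1); [|exact H].
apply C_is_derive_id.
Qed.

Lemma in_disc_0 : in_disc 0.
Proof. unfold in_disc. rewrite Cmod_0. lra. Qed.

(* [g = z / f] and [k] collects its Taylor remainder, [g = 1 - a_2 z + z^2 k];
   the expression in the definition of U is then [- z^2 (k + z k')]. *)
Lemma class_U_structure (f : C -> C) (a : nat -> C) :
  in_class_U f a ->
  exists g k k' E : C -> C,
    (forall z, in_disc z -> g z * f z = z /\ g z <> 0)
    /\ hol 1 f
    /\ (forall z, in_disc z -> g z = 1 - a 2%nat * z + z ^ 2 * k z)
    /\ hol 1 E
    /\ (forall z, in_disc z -> is_derive k z (k' z))
    /\ (forall z, in_disc z -> (Cmod (z ^ 2 * (k z + z * k' z)) <= 1)%R)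
    /\ (forall z, in_disc z -> k z + z * k' z =
        (a 2%nat ^ 2 - a 3%nat)
        + 2 * (2 * a 2%nat * a 3%nat - a 2%nat ^ 3 - a 4%nat) * z
        + 3 * (a 2%nat ^ 4 - 3 * a 2%nat ^ 2 * a 3%nat + a 3%nat ^ 2
               + 2 * a 2%nat * a 4%nat - a 5%nat) * z ^ 2
        + z ^ 3 * E z).
Proof.
intros [(Ha0 & Ha1 & Hs) HU].
assert (P0 : pconv a f) by exact Hs.
destruct (pconv_shift _ _ P0) as (phi & P1 & E0).
destruct (pconv_shift _ _ P1) as (f2 & P2 & E1).
destruct (pconv_shift _ _ P2) as (f3 & P3 & E2).
destruct (pconv_shift _ _ P3) as (f4 & P4 & E3).
destruct (pconv_shift _ _ P4) as (f5 & P5 & E4).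
destruct (pconv_shift _ _ P5) as (psi & P6 & E5).
cbv beta in *. rewrite Ha0 in E0. rewrite Ha1 in E1.
set (a2 := a 2%nat) in *. set (a3 := a 3%nat) in *. set (a4 := a 4%nat) in *. set (a5 := a 5%nat) in *.
assert (Hphi : forall z, in_disc z ->
  phi z = 1 + a2 * z + a3 * z ^ 2 + a4 * z ^ 3 + a5 * z ^ 4 + z ^ 5 * psi z).
{ intros z Hz. rewrite E1, E2, E3, E4, E5 by exact Hz. ring. }
assert (Nphi : forall z, in_disc z -> phi z <> 0).
{ intros z Hz. destruct (Ceq_dec z 0) as [->|Nz].
  - rewrite Hphi by exact Hz. replace (1 + _ + _ + _ + _ + _) with (RtoC 1) by ring.
    exact C1_nz.
  - destruct (HU z Hz Nz) as [Nf _]. intros E. apply Nf. rewrite E0, E by exact Hz. ring. }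
(* The coefficients of [1 / phi] up to degree 4, with [S4] the truncated reciprocal. *)
set (b1 := - a2). set (b2 := a2 ^ 2 - a3). set (b3 := 2 * a2 * a3 - a2 ^ 3 - a4).
set (b4 := a2 ^ 4 - 3 * a2 ^ 2 * a3 + a3 ^ 2 + 2 * a2 * a4 - a5).
set (S4 := fun z => 1 + b1 * z + b2 * z ^ 2 + b3 * z ^ 3 + b4 * z ^ 4).
(* Chosen so that the degree-4 Taylor polynomial [P] of [phi] satisfies [P * S4 + z^5 * p = 1];
   dividing by [phi] then gives [g = S4 + z^5 * m]. *)
set (p := fun z => - (a2 * b4 + a3 * b3 + a4 * b2 + a5 * b1) - (a3 * b4 + a4 * b3 + a5 * b2) * z
  - (a4 * b4 + a5 * b3) * z ^ 2 - a5 * b4 * z ^ 3).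
set (g := fun z => / phi z).
set (m := fun z => (p z - psi z * S4 z) * g z).
(* Order 2, because the final remainder contains [m'] and must itself have order 1. *)
assert (Hg : hol 2 g) by (apply hol_inv; [exact Nphi | exact (hol_pseries 2 _ _ P1)]).
assert (Hm : hol 2 m).
{ apply (hol_mult 2 (fun z => p z - psi z * S4 z) g); [|exact Hg].
  pose proof (hol_pseries 2 _ _ P6) as Hpsi. unfold p, S4. hol_auto. }
assert (Gm : forall z, in_disc z -> g z = S4 z + z ^ 5 * m z).
{ intros z Hz. unfold m.
  assert (K : phi z * S4 z + z ^ 5 * (p z - psi z * S4 z) = 1).
  { rewrite Hphi by exact Hz. unfold S4, p, b4, b3, b2, b1. ring. }
  rewrite <- (Cmult_1_l (g z)) at 1. rewrite <- K.
  unfold g at 1. rewrite Cmult_plus_distr_r.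
  replace (phi z * S4 z * / phi z) with (S4 z) by (field; auto). unfold g. ring. }
pose proof (hol_pred _ _ Hm) as Hm1.
destruct Hm as (m' & Dm & Hm').
set (k := fun z => b2 + z * (b3 + z * (b4 + z * m z))).
set (k' := fun z => (b3 + z * (b4 + z * m z)) + z * ((b4 + z * m z) + z * (m z + z * m' z))).
assert (Dk : forall z, in_disc z -> is_derive k z (k' z)).
{ intros z Hz. unfold k, k'.
  apply (is_derive_horner b2 (fun z => b3 + z * (b4 + z * m z))).
  apply (is_derive_horner b3 (fun z => b4 + z * m z)).
  apply (is_derive_horner b4 m). now apply Dm. }
assert (Gk : forall z, in_disc z -> g z = 1 + z * (b1 + z * k z)).
{ intros z Hz. rewrite Gm by exact Hz. unfold S4, k. ring. }
assert (Gf : forall z, in_disc z -> g z * f z = z).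
{ intros z Hz. unfold g. rewrite E0 by exact Hz. field. auto. }
(* From [k + z k' = (z k)'] with [z k = b2 z + b3 z^2 + b4 z^3 + z^4 m]: this yields the factors 2
   and 3 and the remainder [4 m + z m']. *)
exists g, k, k', (fun z => 4 * m z + z * m' z).
repeat apply conj.
- intros z Hz. split; [now apply Gf|].
  intros E. apply C1_nz. rewrite <- (Cinv_l (phi z)) by auto.
  change (g z * phi z = 0). rewrite E. ring.
- exact (hol_pseries 1 _ _ P0).
- intros z Hz. rewrite Gk by exact Hz. unfold b1. ring.
- assert (Hm1' : hol 1 m') by exact Hm'. hol_auto.
- exact Dk.
- intros z Hz. destruct (Ceq_dec z 0) as [->|Nz].
  + replace (0 ^ 2 * _) with (RtoC 0) by ring. rewrite Cmod_0. lra.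
  + destruct (HU z Hz Nz) as [Nf (d & Hd & Bd)].
    set (g' := (b1 + z * k z) + z * (k z + z * k' z)).
    assert (Dg : is_derive g z g').
    { apply (is_derive_ext_loc (fun z => 1 + z * (b1 + z * k z))).
      - apply (filter_imp in_disc); [|now apply locally_disc]. intros w Hw. symmetry. now apply Gk.
      - unfold g'. apply (is_derive_horner 1 (fun z => b1 + z * k z)).
        apply (is_derive_horner b1 k). now apply Dk. }
    (* Differentiating [g f = z] gives [g' f + g f' = 1], hence [g^2 f' = g - z g']. *)
    assert (Dgf : is_derive (fun w => g w * f w) z (RtoC 1)).
    { apply (is_derive_ext_loc (fun w : C => w)).
      - apply (filter_imp in_disc); [|now apply locally_disc]. intros w Hw.
        exact (eq_sym (Gf w Hw)).
      - apply C_is_derive_id. }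
    pose proof (C_is_derive_uniq _ _ _ _ Dgf (C_is_derive_mult g f z g' d Dg Hd)) as U.
    assert (Q : z / f z = g z) by (rewrite <- (Gf z Hz) at 1; field; exact Nf).
    rewrite Q in Bd.
    replace (g z ^ 2 * d - 1) with (- (z ^ 2 * (k z + z * k' z))) in Bd.
    * rewrite Cmod_opp in Bd. lra.
    * replace (g z ^ 2 * d) with (g z * (1 - g' * f z)) by (rewrite U; ring).
      replace (g z * (1 - g' * f z)) with (g z - g' * (g z * f z)) by ring.
      rewrite (Gf z Hz), (Gk z Hz). unfold g'. ring.
- intros z Hz. unfold k, k', b2, b3, b4. ring.
Qed.

Lemma class_U_a2 (f g k : C -> C) (a2 : C) :
  hol 1 f ->
  (forall z, in_disc z -> g z * f z = z /\ g z <> 0) ->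
  (forall z, in_disc z -> g z = 1 - a2 * z + z ^ 2 * k z) ->
  (forall z, in_disc z -> (Cmod (k z) <= 1)%R) ->
  (Cmod a2 <= 2)%R.
Proof.
intros Hf Hg Gk Bk. destruct (Rle_or_lt (Cmod a2) 2) as [L|L]; [exact L|exfalso].
(* The radius solves [1 + r = r A]; as [r^2 |k| <= r], this gives [|1 + z^2 k| <= |a2 z|] on
   [|z| = r]. The assumption [A > 2] makes [r < 1]. *)
set (A := Cmod a2) in *. set (r := (/ (A - 1))%R).
assert (Hr : (0 < r < 1)%R).
{ unfold r. split; [apply Rinv_0_lt_compat; lra|].
  rewrite <- Rinv_1. apply Rinv_lt_contravar; lra. }
assert (rA : (r * (A - 1) = 1)%R) by (unfold r; field; lra).
assert (f0 : f 0 = 0).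
{ destruct (Hg 0 in_disc_0) as [E N].
  replace (f 0) with (/ g 0 * (g 0 * f 0)) by (field; exact N). rewrite E. ring. }
assert (K : (fst (a2 * f 0)%C <= - (1 / 2))%R).
{ apply (max_Re (fun z => a2 * f z) r); [hol_auto | exact Hr |].
  intros z Hz. assert (Dz : in_disc z) by (unfold in_disc; lra).
  destruct (Hg z Dz) as [E N].
  assert (HP : (1 / 2 <= fst ((- (a2 * z)) / g z)%C)%R).
  { apply Re_div_half_plane; [exact N|].
    rewrite Gk by exact Dz.
    replace (1 - a2 * z + z ^ 2 * k z - - (a2 * z)) with (1 + z ^ 2 * k z) by ring.
    rewrite Cmod_opp, Cmod_mult. fold A. rewrite Hz.
    eapply Rle_trans; [apply Cmod_triangle|].
    rewrite Cmod_1, Cmod_mult, Cmod_pow, Hz. pose proof (Bk z Dz). pose proof (Cmod_ge_0 (k z)).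
    assert (r ^ 2 * Cmod (k z) <= r)%R by nra. nra. }
  replace (- (a2 * z) / g z) with (- (a2 * f z)) in HP.
  - simpl in HP. simpl. lra.
  - replace (a2 * z) with (a2 * (g z * f z)) by now rewrite E. field. exact N. }
rewrite f0, Cmult_0_r in K. simpl in K. lra.
Qed.

Lemma hankel_bounds (f : C -> C) (a : nat -> C) :
  in_class_U f a -> (Cmod (H22 a) <= 1)%R /\ (Cmod (H31 a) <= 1 / 4)%R.
Proof.
intros HU.
destruct (class_U_structure f a HU) as (g & k & k' & E & Hg & Hf & Gk & HE & Dk & BH & Hexp).
unfold H22, H31.
set (a2 := a 2%nat) in *. set (a3 := a 3%nat) in *. set (a4 := a 4%nat) in *. set (a5 := a 5%nat) in *.
set (d0 := a2 ^ 2 - a3) in *. set (d1 := 2 * (2 * a2 * a3 - a2 ^ 3 - a4)) in *.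
set (d2 := 3 * (a2 ^ 4 - 3 * a2 ^ 2 * a3 + a3 ^ 2 + 2 * a2 * a4 - a5)) in *.
set (H := fun z => d0 + d1 * z + d2 * z ^ 2 + z ^ 3 * E z).
assert (BH' : forall z, in_disc z -> (Cmod (H z) <= 1)%R).
{ apply max_modulus; [unfold H; hol_auto|]. intros z Hz. unfold H. rewrite <- Hexp by exact Hz. now apply BH. }
assert (Bk : forall z, in_disc z -> (Cmod (k z) <= 1)%R).
{ apply (radial_mean_bound k k' Dk). intros z Hz. rewrite Hexp by exact Hz. now apply BH'. }
pose proof (class_U_a2 f g k a2 Hf Hg Gk Bk) as B2.
pose proof (bessel3 E d0 d1 d2 HE BH') as Bes.
pose proof (schwarz_pick0 E d0 d1 d2 HE BH') as SP.
pose proof (Cmod_ge_0 d0). pose proof (Cmod_ge_0 d1). pose proof (Cmod_ge_0 d2). pose proof (Cmod_ge_0 a2).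
split.
(* [|a2| |d1| / 2 + |d0|^2 <= |d1| + |d0|^2 <= 1]. *)
- replace (a2 * a4 - a3 ^ 2) with (- (a2 * d1 * (1 / 2)%R) + - (d0 * d0))
    by (rewrite !RtoC_div by lra; unfold d0, d1; field).
  eapply Rle_trans; [apply Cmod_triangle|].
  rewrite !Cmod_opp, !Cmod_mult, !Cmod_R, !Rabs_pos_eq by lra.
  nra.
- replace (a3 * (a2 * a4 - a3 ^ 2) - a4 * (a4 - a2 * a3) + a5 * (a3 - a2 ^ 2))
    with (d0 * d2 * (1 / 3)%R + - (d1 * d1 * (1 / 4)%R))
    by (rewrite !RtoC_div by lra; unfold d0, d1, d2; field).
  eapply Rle_trans; [apply Cmod_triangle|].
  rewrite !Cmod_opp, !Cmod_mult, !Cmod_R, !Rabs_pos_eq by lra. 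
  (* [|d0| |d2| / 3 <= (|d0|^2 + |d2|^2) / 6], so the sum is at most a quarter of Bessel's left-hand
     side. *)
  pose proof (pow2_ge_0 (Cmod d0 - Cmod d2)). nra.
Qed.

(** * Extremal functions *)

Lemma is_derive_Cpow (n : nat) (z : C) : is_derive (fun w => w ^ S n) z (INR (S n) * z ^ n).
Proof.
induction n as [|n IH].
- replace (INR 1 * z ^ 0) with (1 * 1 + z * 0) by (simpl; ring).
  apply (C_is_derive_mult (fun w => w) (fun _ => 1)); [|exact (is_derive_const (RtoC 1) z)].
  apply C_is_derive_id.
- replace (INR (S (S n)) * z ^ S n) with (1 * z ^ S n + z * (INR (S n) * z ^ n))
    by (rewrite (S_INR (S n)), RtoC_plus; simpl Cpow; ring).
  apply (C_is_derive_mult (fun w => w) (fun w => w ^ S n)); [|exact IH].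
  apply C_is_derive_id.
Qed.

Lemma pconv_zeros (m : nat) (c : nat -> C) (F : C -> C) :
  (forall i, (i < m)%nat -> c i = 0) -> pconv c F ->
  exists G, pconv (fun n => c (m + n)%nat) G /\ forall z, in_disc z -> F z = z ^ m * G z.
Proof.
revert c F. induction m as [|m IH]; intros c F Hc HF.
- exists F. split; [exact HF|]. intros z _. simpl. ring.
- destruct (pconv_shift c F HF) as (F1 & P1 & E1).
  destruct (IH (fun n => c (S n)) F1) as (G & PG & EG); [intros i Hi; apply Hc; lia | exact P1|].
  exists G. split; [exact PG|]. intros z Hz.
  rewrite E1, EG, Hc by (exact Hz || lia). simpl. ring.
Qed.

(* Taylor coefficients of [z / (1 - c z ^ m)]. *)
Definition geo (m : nat) (c : R) (n : nat) : C :=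
  match n with
  | O => 0
  | S k => if (k mod m =? 0)%nat then (c ^ (k / m))%R else 0
  end.

(** With [m = p + 2] and [z / f = 1 - c z^m], the expression [(z / f)^2 f' - 1] equals
    [(m - 1) c z^m], which explains the second hypothesis. The first keeps the coefficients bounded
    and the denominator away from 0. *)
Lemma geo_class_U (p : nat) (c : R) :
  (Rabs c <= 1)%R -> (Rabs (INR (S p) * c) <= 1)%R ->
  in_class_U (fun z => z / (1 - c * z ^ S (S p))) (geo (S (S p)) c).
Proof.
set (m := S (S p)). intros Hc Hpc.
assert (Hm : m <> 0%nat) by discriminate.
assert (Small : forall z, in_disc z -> (Cmod (c * z ^ m) < 1)%R).
{ intros z Hz. unfold in_disc in Hz. pose proof (Cmod_ge_0 z).
  rewrite Cmod_mult, Cmod_R, Cmod_pow. pose proof (Rabs_pos c).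
  assert (Cmod z ^ m < 1)%R by (apply pow_lt_1_compat; [lra | unfold m; lia]).
  assert (0 <= Cmod z ^ m)%R by (apply pow_le; lra). nra. }
assert (Den : forall z, in_disc z -> 1 - c * z ^ m <> 0).
{ intros z Hz E. pose proof (Small z Hz) as S1.
  replace (c * z ^ m) with (1 - (1 - c * z ^ m)) in S1 by ring. rewrite E in S1.
  replace (1 - 0) with (RtoC 1) in S1 by ring. rewrite Cmod_1 in S1. lra. }
set (b := fun n => geo m c (S n)).
assert (Bb : forall n, (Cmod (b n) <= 1)%R).
{ intros n. unfold b, geo. destruct (n mod m =? 0)%nat; [|rewrite Cmod_0; lra].
  rewrite Cmod_R, <- RPow_abs. rewrite <- (pow1 (n / m)). apply pow_incr. split; [apply Rabs_pos | exact Hc]. }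
assert (Pb : pconv b (CPSeries b)).
{ intros z Hz. apply CPSeries_correct. unfold in_disc in Hz.
  assert (Bd : forall n, (Cmod (z ^ n * b n) <= Cmod z ^ n)%R).
  { intros n. rewrite Cmod_mult, Cmod_pow. pose proof (Bb n).
    assert (0 <= Cmod z ^ n)%R by (apply pow_le, Cmod_ge_0). pose proof (Cmod_ge_0 (b n)). nra. }
  assert (Ex : ex_series (fun n => (Cmod z ^ n)%R)).
  { apply ex_series_geom. rewrite Rabs_pos_eq; [exact Hz | apply Cmod_ge_0]. }
  destruct (ex_series_le (V := C_CompleteNormedModule) _ _ Bd Ex) as [l Hl].
  exists l. now apply is_pseries_C. }
assert (Gb : forall z, in_disc z -> CPSeries b z = / (1 - c * z ^ m)).
(* The coefficients start with 1, vanish at indices 1 to [m - 1], and satisfy [b (m + n) = c * b n];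
   so the sum [X] solves [X = 1 + c z^m X]. *)
{ destruct (pconv_shift b _ Pb) as (F1 & P1 & E1).
  assert (Z : forall i, (i < S p)%nat -> b (S i) = 0).
  { intros i Hi. unfold b, geo. rewrite Nat.mod_small by (unfold m; lia). reflexivity. }
  destruct (pconv_zeros (S p) (fun n => b (S n)) F1 Z P1) as (G & PG & EG).
  assert (Rec : forall n, b (m + n)%nat = c * b n).
  { intros n. unfold b, geo. replace (m + n)%nat with (n + 1 * m)%nat by lia.
    rewrite Nat.Div0.mod_add, Nat.div_add by exact Hm.
    destruct (n mod m =? 0)%nat; [|ring].
    rewrite Nat.add_comm. simpl. now rewrite RtoC_mult. }
  intros z Hz.
  assert (EG2 : G z = c * CPSeries b z).
  { apply (is_series_C_unique _ _ _ (proj1 (is_pseries_C _ _ _) (PG z Hz))).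
    pose proof (is_series_scal_l (V := C_NormedModule) (RtoC c) _ _ (proj1 (is_pseries_C _ _ _) (Pb z Hz))) as S1.
    revert S1. apply is_series_ext. intros n.
    change (c * (z ^ n * b n) = z ^ n * b (m + n)%nat). rewrite Rec. ring. }
  assert (E : CPSeries b z * (1 - c * z ^ m) = 1).
  { pose proof (E1 z Hz) as EX. rewrite EG, EG2 in EX by exact Hz.
    assert (B0 : b 0%nat = 1).
    { unfold b, geo. rewrite Nat.Div0.mod_0_l, Nat.Div0.div_0_l. reflexivity. }
    rewrite B0 in EX. set (X := CPSeries b z) in *.
    replace (X * (1 - c * z ^ m)) with (X - z * (z ^ S p * (c * X))) by (unfold m; simpl; ring).
    rewrite EX at 1. ring. }
  apply (f_equal (fun y => y * / (1 - c * z ^ m))) in E.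
  rewrite Cmult_1_l in E. rewrite <- E. field. now apply Den. }
split; [split; [|split]|].
- reflexivity.
- unfold geo. rewrite Nat.Div0.mod_0_l, Nat.Div0.div_0_l. reflexivity.
- intros z Hz.
  assert (E : z / (1 - c * z ^ m) = scal z (CPSeries b z)).
  { rewrite Gb by exact Hz. reflexivity. }
  rewrite E. pose proof (is_pseries_incr_1 b z _ (Pb z Hz)) as S1.
  revert S1. apply is_pseries_ext. intros [|n]; reflexivity.
- intros z Hz Nz. pose proof (Den z Hz) as D.
  split.
  { intros E. apply Nz. rewrite <- (Cmult_1_r z), <- (Cinv_l _ D), Cmult_assoc.
    unfold Cdiv in E. rewrite E. ring. }
  exists (1 * / (1 - c * z ^ m)
    + z * ((0 + INR m * z ^ S p * - c) * - / ((1 - c * z ^ m) * (1 - c * z ^ m)))).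
  split.
  + apply (C_is_derive_mult (fun w => w) (fun w => / (1 - c * w ^ m)) z 1).
    { apply C_is_derive_id. }
    apply (C_is_derive_comp Cinv (fun w => 1 - c * w ^ m)); [now apply C_is_derive_inv|].
    apply (is_derive_ext (fun w : C => 1 + w ^ m * - c)).
    { intros w. change (1 + w ^ m * - c = 1 - c * w ^ m). ring. }
    apply (C_is_derive_plus (fun _ => 1) (fun w => w ^ m * - c)); [exact (is_derive_const (RtoC 1) z)|].
    apply (C_is_derive_comp (fun w => w * - c) (fun w => w ^ m));
      [apply C_is_derive_scal | apply is_derive_Cpow].
  + match goal with |- (Cmod ?X < 1)%R => replace X with ((INR (S p) * c)%R * z ^ m : C) end.
    * unfold in_disc in Hz. pose proof (Cmod_ge_0 z).
      rewrite Cmod_mult, Cmod_R, Cmod_pow.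
      assert (Cmod z ^ m < 1)%R by (apply pow_lt_1_compat; [lra | unfold m; lia]).
      assert (0 <= Cmod z ^ m)%R by (apply pow_le; lra).
      pose proof (Rabs_pos (INR (S p) * c)). nra.
    * assert (HI : RtoC (INR m) = INR (S p) + 1)
        by (unfold m; rewrite (S_INR (S p)), RtoC_plus; reflexivity).
      rewrite RtoC_mult, HI.
      change (z ^ m) with (z * z ^ S p) in *.
      field. auto.
Qed.

Theorem theorem1 :
  (forall (f : C -> C) (a : nat -> C), in_class_U f a ->
      (Cmod (H22 a) <= 1)%R /\ (Cmod (H31 a) <= 1 / 4)%R)
  /\ (exists (f : C -> C) (a : nat -> C), in_class_U f a /\ Cmod (H22 a) = 1%R)
  /\ (exists (f : C -> C) (a : nat -> C), in_class_U f a /\ Cmod (H31 a) = (1 / 4)%R).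
Proof.
split; [exact hankel_bounds|split].
(* Here [a_2 = a_4 = 0] and [a_3 = 1], so [H_2(2) = -1]. *)
- exists (fun z => z / (1 - 1%R * z ^ 2)), (geo 2 1). split.
  + apply (geo_class_U 0 1).
    * rewrite Rabs_R1. lra.
    * simpl. rewrite Rmult_1_l, Rabs_R1. lra.
  + replace (H22 (geo 2 1)) with (RtoC (- (1))).
    * rewrite Cmod_R, Rabs_Ropp, Rabs_R1. reflexivity.
    * unfold H22, geo. simpl Nat.modulo. simpl Nat.div. simpl Nat.eqb. cbv iota.
      rewrite RtoC_opp. simpl. rewrite !Rmult_1_r. ring.
(* For [m = 3] the largest admissible [c] is 1/2. Only [a_4 = 1/2] is nonzero among [a_2, ..., a_5],
   so [H_3(1) = - a_4^2 = -1/4]. *)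
- exists (fun z => z / (1 - (1 / 2)%R * z ^ 3)), (geo 3 (1 / 2)). split.
  + apply (geo_class_U 1 (1 / 2)).
    * rewrite Rabs_pos_eq; lra.
    * simpl. rewrite Rabs_pos_eq; lra.
  + replace (H31 (geo 3 (1 / 2))) with (RtoC (- (1 / 4))).
    * rewrite Cmod_R, Rabs_Ropp, Rabs_pos_eq; lra.
    * unfold H31, geo. simpl Nat.modulo. simpl Nat.div. simpl Nat.eqb. cbv iota.
      replace (- (1 / 4))%R with (- ((1 / 2) * (1 / 2)))%R by field.
      rewrite RtoC_opp, RtoC_mult. simpl. rewrite !Rmult_1_r. ring.
Qed.
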